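(* Consider $\epsilon\sim\nu=N(0,\sigma^2I_q)$ with $\delta=\sigma^{1/3}$ and let $\theta^*$ satisfy $$\theta^*=\operatorname*{arg\,min}_{\theta\in\Theta}\mathcal{L}(\theta;\mu,\nu),\qquad \mathcal{L}(\theta;\mu,\nu)=\mathbb{E}_{u\sim\mu,\,\epsilon\sim\nu}\big[\|f_\theta^\tau(A_{p,q}u+\epsilon)-Wu\|_{\ell^2}^2\big].$$ There exists $\sigma_1>0$ such that, for $\sigma\le\min\{\sigma_1,q^{-1/2}\}$, it holds $$\mathcal{L}(\theta^*;\mu,\nu)\le c^*\delta^2 .$$ That is, the random variable $f_{\theta^*}^\tau(A_{p,q}u+\epsilon)$ converges to $Wu$ in mean as $\delta\to0$.
   Context: $X=L^2(\Omega)$, $\Omega\subset\mathbb{R}^2$ (e.g. $[0,1]^2$), $Y$ is a Hilbert space, $A:X\to Y$ is an injective bounded linear operator such that $A^*A$ is a convolutional kernel operator, i.e. $(A^*A\psi_I,\psi_{I'})_X=\iint K(x-x')\psi_I(x)\psi_{I'}(x')\,dx\,dx'$. $\{\psi_I\}$ is an orthonormal 2D wavelet basis of $X$; its first $p=2^{2J}$ elements are $\psi_{j,k}^{(t)}(x)=2^j\psi^{(t)}(2^jx-k)$ with scales $j\in\{J_0,\ldots,J-1\}$, types $(t)\in\{(v),(h),(d)\}$ (and also $(f)$ for $j=J_0$), offsets $k\in\{0,\ldots,2^j-1\}^2$, where $\psi^{(v)}=\phi\otimes\psi$, $\psi^{(h)}=\psi\otimes\phi$, $\psi^{(d)}=\psi\otimes\psi$,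 $\psi^{(f)}=\phi\otimes\phi$ for a mother wavelet $\psi$ and scaling function $\phi$ supported in $[0,1]$. $W:X\to\ell^2(\mathbb{N})$, $(Wu)_I=(u,\psi_I)_X$; $\{\varphi_j\}$ is an orthogonal basis of $Y$; $X_p=\mathrm{span}\{\psi_I\}_{I=1}^p$; $W_p=\{w\in\mathbb{R}^{\mathbb{N}}:w_I=0\ \forall I>p\}\cong\mathbb{R}^p$; $\mathbb{P}_p$ is the orthogonal projection of $\ell^2(\mathbb{N})$ onto $W_p$; $\widetilde{\mathbb{P}}_p=W^*\mathbb{P}_pW$; $Y_q=\mathrm{span}\{\varphi_j\}_{j=1}^q$ (identified with $\mathbb{R}^q$); $\mathbb{P}_q$ is the orthogonal projection of $Y$ onto $Y_q$; $A_{p,q}=\mathbb{P}_qA\widetilde{\mathbb{P}}_p^*$. Probabilistic setting: $\mathcal{B}=\{u\in X_p: Wu\in\ell^1(\mathbb{N}),\ \|Wu\|_{\ell^1}\le C_{\mathcal{B}}\}$; $u$ is a random variable with probability distribution $\mu$ on $\mathcal{B}$; $\epsilon$ is a random variable in $Y_q$ with distribution $\nu$, independent of $u$. Network: for $\theta\in\Theta$, $f_\theta^\tau$ is the map $m\mapsto w^{(N)}$ with $w^{(n)}=\mathcal{S}_{\lambda/(2L)}\big(w^{(n-1)}-\tfrac1LK^{(n)}w^{(n-1)}+\tfrac1LWA_{p,q}^*m\big)$, $n=1,\ldots,N$, from a fixed $w^{(0)}\in\mathbb{R}^p$, where $\mathcal{S}_\beta$ is componentwise soft-thresholding ($w_I+\beta$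 if $w_I<-\beta$; $0$ if $|w_I|\le\beta$; $w_I-\beta$ if $w_I>\beta$). Each $K^{(n)}\in\mathbb{R}^{p\times p}$ is described by convolutional filters: for every pair of subbands $(j,(t))$, $(j',(t'))$ there is a filter $F$ indexed by $d\in\{-2^{\hat j}+1,\ldots,2^{\hat j}-1\}^2$, $\hat j=\max(j,j')$, such that the entry of $K^{(n)}$ in column $(j,(t),k)$ and row $(j',(t'),k')$ equals $F_d$ with $d=2^{\hat j-j'}k'-2^{\hat j-j}k$. The entries of $F$ outside its central $\tau\times\tau$ submatrix are fixed equal to $\iint K(x-x'-2^{-\hat j}d)\psi_{j',0}^{(t')}(x')\psi_{j,0}^{(t)}(x)\,dx\,dx'$; the central $\tau\times\tau$ entries are free parameters. $\theta$ collects these parameters over all filters and all $N$ layers (possibly together with other learnable parameters such as $L$ and $\lambda$), and $\Theta$ is the set of parameters. Reference parameter: $\Theta$ contains $\theta_0$ for which $f_{\theta_0}^\tau$ is equivalent to $N$ iterations of (perturbed) ISTA, i.e. all $K^{(n)}$ equal an operator $Z$ with $\|WA_{p,q}^*A_{p,q}W^*-Z\|_{\ell^2\to\ell^2}\le\rho$, with parameters chosen in terms of $\delta$: $\lambda=c_0\delta$, $L\ge\|WA_{p,q}^*A_{p,q}W^*\|$, $N=\lceil\log_a\delta\rceil$ ($0<a<1$ a linear convergence rate of the unperturbed ISTA iterates, i.e. those with $Z=WA_{p,q}^*A_{p,q}W^*$), $\rho=\delta/N$, and $p,q$ such that $\|w-\mathbb{P}_pw\|_{\ell^2}\le c_p\delta$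 for $w=Wu$, $u\in\mathcal{B}$, and $\|(I-\mathbb{P}_q)A\|_{X\to Y}\le c_q\delta$. Constants: $c_5>0$ is such that, for all sufficiently small $\delta$, $\|f_{\theta_0}^\tau(A_{p,q}u+\epsilon)-Wu\|_{\ell^2}\le c_5\delta$ for all $u\in\mathcal{B}$ and $\epsilon\in Y_q$ with $\|\epsilon\|\le\delta$; $k_1,k_2>0$ (depending on $C_{\mathcal{B}},L,\rho,\|A_{p,q}\|,w^{(0)},N$) are such that $\|f_{\theta_0}^\tau(A_{p,q}u+\epsilon)-Wu\|_{\ell^2}\le k_1+k_2\|\epsilon\|_{Y_q}$ for all $u\in\mathcal{B}$, $\epsilon\in Y_q$; and $c^*$ is a positive constant depending only on $c_5,k_1,k_2$. *)

(* Defs.v *)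
From HB Require Import structures.
From mathcomp Require Import all_boot all_order all_algebra.
From mathcomp Require Import all_classical all_reals all_analysis.

Set Implicit Arguments.
Unset Strict Implicit.
Unset Printing Implicit Defensive.

Import Order.TTheory GRing.Theory Num.Theory.
Import numFieldNormedType.Exports.

Local Open Scope classical_set_scope.
Local Open Scope ring_scope.

Section sequences.
Context {R : realType}.

Definition l1norm (w : nat -> R) : \bar R := 'N[counting]_1%:E [EFin \o w].

Definition l2norm (w : nat -> R) : \bar R := 'N[counting]_2%:E [EFin \o w].

Definition proj_seq (p : nat) (w : nat -> R) : nat -> R :=
  fun I => if (I < p)%N then w I else 0.

(* The identification of R^p with the sequences vanishing from index p on. *)
Definition zext (p : nat) (w : 'cV[R]_p) : nat -> R :=
  fun I => if insub I is Some i then w i 0 else 0.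

Definition trunc (p : nat) (w : nat -> R) : 'cV[R]_p := \col_(i < p) w i.

(* [c] bounds the operator norm of the matrix [M] on (R^p, l2). *)
Definition opnorm_le (p : nat) (M : 'M[R]_p) (c : R) : Prop :=
  forall w : 'cV[R]_p,
    (l2norm (zext (M *m w)) <= c%:E * l2norm (zext w))%E.

End sequences.

Notation plane R := (measurableTypeR R * measurableTypeR R)%type.

Section L2.
Context {R : realType}.

Definition leb1 : {sigma_finite_measure set (measurableTypeR R) -> \bar R} :=
  @lebesgue_measure R.

Definition leb2 : set (plane R) -> \bar R := (leb1 \x leb1)%E.
HB.instance Definition _ := Measure.on leb2.

Lemma leb2_sigma_finite : sigma_finite setT leb2.
Proof.
have /sigma_finiteP[F [TF ndF Foo]] := sigma_finiteT leb1.
exists (fun n => F n `*` F n).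
  rewrite -setXTT TF predeqE => -[x y]; split.
    move=> [/= [n _ Fnx] [k _ Fky]]; exists (maxn n k) => //; split.
    - by move: x Fnx; exact/subsetPset/ndF/leq_maxl.
    - by move: y Fky; exact/subsetPset/ndF/leq_maxr.
  by move=> [n _ []/= ? ?]; split; exists n.
move=> k; have [? ?] := Foo k; split; first exact: measurableX.
by rewrite /leb2 product_measure1E// lte_mul_pinfty// ge0_fin_numE.
Qed.

HB.instance Definition _ :=
  Measure_isSigmaFinite.Build _ _ _ leb2 leb2_sigma_finite.

HB.instance Definition _ d (T : measurableType d)
    (mu : {measure set T -> \bar R}) (p : \bar R) (p1 : (1 <= p)%E) :=
  isPointed.Build (LfunType mu p1) 0.

(* Elements of L^2(Omega) are represented by square-integrable functions on the
   plane for the Lebesgue measure restricted to Omega; two of them denote the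
   same element iff they agree almost everywhere for this measure. *)
Definition L2 (Omega : set (plane R)) (mO : measurable Omega) :=
  LfunType (mrestr leb2 mO) (lee1n 2).

Definition ipX (Omega : set (plane R)) (mO : measurable Omega) (f g : L2 mO) : R :=
  \int[mrestr leb2 mO]_x (f x * g x).

Definition normX (Omega : set (plane R)) (mO : measurable Omega) (f : L2 mO) : R :=
  Num.sqrt (ipX f f).

Definition eqX (Omega : set (plane R)) (mO : measurable Omega) (f g : L2 mO) :=
  ae_eq (mrestr leb2 mO) setT f g.

End L2.

Variant wtype := Wv | Wh | Wd | Wf.

Definition band : Type := (nat * wtype)%type.

(* The n-th wavelet index: its subband and its offset.  The 4 ^ J0 coarsest
   (f)-functions come first; the indices n with 4 ^ j <= n < 4 ^ j.+1 and
   j >= J0 enumerate the three types at scale j.  Hence, for J >= J0, the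
   indices of scale < J (including all of type (f)) are those below 4 ^ J. *)
Definition windex (J0 n : nat) : band * (nat * nat) :=
  if (n < 4 ^ J0)%N then ((J0, Wf), (n %/ 2 ^ J0, n %% 2 ^ J0)%N)
  else
    let j := trunc_log 4 n in
    let r := (n - 4 ^ j)%N in
    let s := (r %% 4 ^ j)%N in
    ((j, nth Wd [:: Wv; Wh] (r %/ 4 ^ j)), (s %/ 2 ^ j, s %% 2 ^ j)%N).

Section wavelets.
Context {R : realType} (phi psi : R -> R).

Definition wtensor (t : wtype) (x : plane R) : R :=
  match t with
  | Wv => phi x.1 * psi x.2
  | Wh => psi x.1 * phi x.2
  | Wd => psi x.1 * psi x.2
  | Wf => phi x.1 * phi x.2
  end.

Definition wavelet (b : band) (k : nat * nat) (x : plane R) : R :=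
  2 ^+ b.1 *
  wtensor b.2 (2 ^+ b.1 * x.1 - k.1%:R, 2 ^+ b.1 * x.2 - k.2%:R).

End wavelets.

Record problem (R : realType) (Y : completeNormedModType R) := Problem {
  Omega : set (plane R);
  mOmega : measurable Omega;
  phi : R -> R;                      (* scaling function *)
  psi : R -> R;                      (* mother wavelet *)
  J0 : nat;
  wav : nat -> L2 mOmega;            (* the basis psi_I of X = L^2(Omega) *)
  A : {linear L2 mOmega -> Y};
  Aadj : Y -> L2 mOmega;             (* adjoint of A *)
  kerK : plane R -> R;               (* convolution kernel of A^*A *)
  ipY : Y -> Y -> R;                 (* inner product of Y *)
  basY : nat -> Y                    (* orthogonal basis of Y *)
}.

Section problem_theory.
Context {R : realType} {Y : completeNormedModType R} (P : problem Y).

Notation X := (L2 (mOmega P)).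

Definition Y_hilbert : Prop :=
  [/\ forall y z : Y, ipY P y z = ipY P z y,
      forall (c : R) (x y z : Y),
        ipY P (c *: x + y) z = c * ipY P x z + ipY P y z
    & forall y : Y, ipY P y y = `|y| ^+ 2].

Definition Y_orthogonal_basis : Prop :=
  [/\ forall j, basY P j != 0,
      forall i j, i != j -> ipY P (basY P i) (basY P j) = 0
    & forall (y : Y) (e : R), 0 < e ->
        exists n (c : 'I_n -> R), `|y - \sum_(j < n) c j *: basY P j| < e].

Definition X_orthonormal_wavelet_basis : Prop :=
  [/\ forall x, ~~ (0 <= x <= 1) -> phi P x = 0 /\ psi P x = 0,
      forall I x,
        wav P I x
        = wavelet (phi P) (psi P) (windex (J0 P) I).1 (windex (J0 P) I).2 x,
      forall I I', ipX (wav P I) (wav P I') = (I == I')%:R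
    & forall (u : X) (e : R), 0 < e ->
        exists n (c : 'I_n -> R), normX (u - \sum_(I < n) c I *: wav P I) < e].

Definition A_bounded : Prop :=
  exists C : R, forall u : X, `|A P u| <= C * normX u.

Definition A_injective : Prop :=
  forall u v : X, A P u = A P v -> eqX u v.

Definition A_adjoint : Prop :=
  forall (u : X) (y : Y), ipY P (A P u) y = ipX u (Aadj P y).

Definition conv_integrand (I I' : nat) (z : plane R * plane R) : R :=
  kerK P (z.1.1 - z.2.1, z.1.2 - z.2.2) * wav P I z.1 * wav P I' z.2.

Definition AA_convolutional : Prop :=
  forall I I',
    (leb2 \x leb2)%E.-integrable (Omega P `*` Omega P)
      (EFin \o conv_integrand I I')
    /\ ipX (Aadj P (A P (wav P I))) (wav P I')
       = \int[(leb2 \x leb2)%E]_(z in Omega P `*` Omega P)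
           conv_integrand I I' z.

Definition standing_assumptions : Prop :=
  [/\ Y_hilbert, Y_orthogonal_basis & X_orthonormal_wavelet_basis] /\
  [/\ A_bounded, A_injective, A_adjoint & AA_convolutional].

Definition W (u : X) : nat -> R := fun I => ipX u (wav P I).

Definition Xspan (p : nat) : set X :=
  [set u | exists c : 'I_p -> R, eqX u (\sum_(I < p) c I *: wav P I)].

Definition Yspan (q : nat) : set Y :=
  [set y | exists c : 'I_q -> R, y = \sum_(j < q) c j *: basY P j].

(* W^* P_p: the adjoint of W on the sequences supported in the first p indices. *)
Definition Wadj (p : nat) (w : nat -> R) : X := \sum_(I < p) w I *: wav P I.

(* W^* P_p W, a self-adjoint operator. *)
Definition projX (p : nat) (u : X) : X := Wadj p (W u).

Definition projY (q : nat) (y : Y) : Y :=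
  \sum_(j < q) (ipY P y (basY P j) / `|basY P j| ^+ 2) *: basY P j.

Definition Apq (p q : nat) (u : X) : Y := projY q (A P (projX p u)).

Definition Apq_adj (p q : nat) (m : Y) : X := projX p (Aadj P (projY q m)).

Definition WApq_adj (p q : nat) (m : Y) : 'cV[R]_p :=
  trunc p (W (Apq_adj p q m)).

(* W A_pq^* A_pq W^* on R^p. *)
Definition gram (p q : nat) : 'M[R]_p :=
  \matrix_(I' < p, I < p) WApq_adj p q (Apq p q (wav P I)) I' 0.

(* R^q is identified isometrically with the span of the first q vectors of the
   orthogonal, not necessarily normalized, basis. *)
Definition embY (q : nat) (t : q.-tuple (measurableTypeR R)) : Y :=
  \sum_(j < q) (tnth t j / `|basY P j|) *: basY P j.

Definition ball1 (CB : R) (p : nat) : set X :=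
  [set u | [/\ Xspan p u, (l1norm (W u) < +oo)%E
             & (l1norm (W u) <= CB%:E)%E]].

(* X with the sigma-algebra generated by the wavelet coefficients, i.e. the
   Borel sigma-algebra of the separable Hilbert space L^2(Omega). *)
Definition coef_events : set (set X) :=
  [set S | exists (I : nat) (B : set (measurableTypeR R)),
             measurable B /\ S = (fun u : X => W u I) @^-1` B].

(* [free n b b' d] is the entry d of the filter from the subband b (columns) to
   the subband b' (rows) in layer n; it is used only when d lies in the central
   window. *)
Record params := Params {
  free : nat -> band -> band -> int * int -> R;
  lip : R;                                      (* L *)
  lam : R                                       (* lambda *)
}.

(* The central tau x tau window; for odd tau it is |d_i| <= (tau - 1) / 2. *)
Definition central (tau : nat) (d : int * int) : bool :=
  [&& - tau%:Z < d.1 * 2, d.1 * 2 <= tau%:Z,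
      - tau%:Z < d.2 * 2 & d.2 * 2 <= tau%:Z].

Definition fixed_entry (b b' : band) (d : int * int) : R :=
  let h := maxn b.1 b'.1 in
  \int[(leb2 \x leb2)%E]_(z in Omega P `*` Omega P)
    (kerK P (z.1.1 - z.2.1 - d.1%:~R / 2 ^+ h,
             z.1.2 - z.2.2 - d.2%:~R / 2 ^+ h)
     * wavelet (phi P) (psi P) b' (0, 0)%N z.2
     * wavelet (phi P) (psi P) b (0, 0)%N z.1).

Definition filter_entry (tau : nat) (th : params) (n : nat) (b b' : band)
    (d : int * int) : R :=
  if central tau d then free th n b b' d else fixed_entry b b' d.

Definition offset_diff (h j j' k k' : nat) : int :=
  (2 ^ (h - j') * k')%N%:Z - (2 ^ (h - j) * k)%N%:Z.

Definition Kmat (tau p : nat) (th : params) (n : nat) : 'M[R]_p :=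
  \matrix_(I' < p, I < p)
    let: ((j, t), k) := windex (J0 P) I in
    let: ((j', t'), k') := windex (J0 P) I' in
    let h := maxn j j' in
    filter_entry tau th n (j, t) (j', t')
      (offset_diff h j j' k.1 k'.1, offset_diff h j j' k.2 k'.2).

Definition soft (beta x : R) : R :=
  if x < - beta then x + beta else if `|x| <= beta then 0 else x - beta.

(* [unroll M L l b w0 n] is w^(n), where
   w^(n) = S_(l/(2L)) (w^(n-1) - M^(n) w^(n-1) / L + b / L). *)
Fixpoint unroll (p : nat) (M : nat -> 'M[R]_p) (L l : R) (b w0 : 'cV[R]_p)
    (n : nat) : 'cV[R]_p :=
  if n is n'.+1 then
    let w := unroll M L l b w0 n' in
    map_mx (soft (l / (2 * L))) (w - L^-1 *: (M n *m w) + L^-1 *: b)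
  else w0.

(* The objects that may vary with the noise level delta. *)
Record config := Config {
  levelJ : nat;                     (* p = 4 ^ levelJ *)
  dimq : nat;
  winsize : nat;
  depth : nat;
  init : 'cV[R]_(4 ^ levelJ);       (* w^(0) *)
  Theta : set params;
  theta0 : params;                  (* reference parameter *)
  law : probability (g_sigma_algebraType coef_events) R
}.

Definition dimp (C : config) : nat := (4 ^ levelJ C)%N.

Definition net (C : config) (th : params) (m : Y) : 'cV[R]_(dimp C) :=
  unroll (Kmat (winsize C) (dimp C) th) (lip th) (lam th)
    (WApq_adj (dimp C) (dimq C) m) (init C) (depth C).

Definition ista (C : config) (L l : R) (m : Y) (n : nat) : 'cV[R]_(dimp C) :=
  unroll (fun=> gram (dimp C) (dimq C)) L l (WApq_adj (dimp C) (dimq C) m) (init C) n.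

(* || f_theta (A_pq u + eps) - W u ||, in l2 *)
Definition err (C : config) (th : params) (u : X) (eps : Y) : \bar R :=
  l2norm (fun I => zext (net C th (Apq (dimp C) (dimq C) u + eps)) I - W u I).

End problem_theory.
Arguments W {R Y} P u _.
Arguments ball1 {R Y} P CB p _.
Arguments params : clear implicits.

Section gaussian.
Context {R : realType}.

Definition tcons (n : nat)
    (z : measurableTypeR R * n.-tuple (measurableTypeR R)) :
  n.+1.-tuple (measurableTypeR R) := [the _.-tuple _ of z.1 :: z.2].

Lemma measurable_tcons n : measurable_fun setT (@tcons n).
Proof. exact: (measurable_cons measurable_fst measurable_snd). Qed.

HB.instance Definition _ n :=
  @isMeasurableFun.Build _ _ _ _ (@tcons n) (@measurable_tcons n).

(* Product of q copies of N(0, s^2). *)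
Fixpoint gauss (s : R) (q : nat) :
    probability (q.-tuple (measurableTypeR R)) R :=
  match q return probability (q.-tuple (measurableTypeR R)) R with
  | 0%N => dirac [tuple]
  | q'.+1 => distribution (normal_prob 0 s \x gauss s q')%E (@tcons q')
  end.

End gaussian.

Section statement.
Context {R : realType} {Y : completeNormedModType R} {P : problem Y}.

Definition loss (C : config P) (s : R) (th : params R) : \bar R :=
  (\int[law C \x gauss s (dimq C)]_z (err C th z.1 (embY P z.2) ^+ 2))%E.

Definition mean_err (C : config P) (s : R) (th : params R) : \bar R :=
  (\int[law C \x gauss s (dimq C)]_z err C th z.1 (embY P z.2))%E.

Definition is_argmin (C : config P) (s : R) (th : params R) : Prop :=
  Theta C th /\ forall th', Theta C th' -> (loss C s th <= loss C s th')%E.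

Definition linear_rate (a : R) (p : nat) (w : nat -> 'cV[R]_p) : Prop :=
  exists (wlim : 'cV[R]_p) (c : R),
    forall n, (l2norm (zext (w n - wlim)) <= (c * a ^+ n)%:E)%E.

Definition discretization (CB c_p c_q d : R) (C : config P) : Prop :=
  [/\ (J0 P < levelJ C)%N,
      forall u : L2 (mOmega P), ball1 P CB (dimp C) u ->
        (l2norm (fun I => W P u I - proj_seq (dimp C) (W P u) I)%R
           <= (c_p * d)%:E)%E
    & forall u : L2 (mOmega P),
        `|A P u - projY P (dimq C) (A P u)| <= c_q * d * normX u].

Definition law_on_ball (CB : R) (C : config P) : Prop :=
  {ae law C, forall u : L2 (mOmega P), ball1 P CB (dimp C) u}.

(* The network of parameter theta0 performs N steps of perturbed ISTA. *)
Definition reference (c0 a d : R) (C : config P) : Prop :=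
  let G := gram P (dimp C) (dimq C) in
  let th0 := theta0 C in
  [/\ Theta C th0,
      lam th0 = c0 * d,
      opnorm_le G (lip th0),
      forall m, Yspan P (dimq C) m ->
        linear_rate a (ista C (lip th0) (lam th0) m)
    & (depth C)%:Z = Num.ceil (ln d / ln a)]
  /\ exists Z : 'M[R]_(dimp C),
      opnorm_le (G - Z) (d / (depth C)%:R) /\
      forall n, (1 <= n <= depth C)%N ->
        Kmat P (winsize C) (dimp C) th0 n = Z.

Definition small_noise_bound (CB c5 d : R) (C : config P) : Prop :=
  forall u eps, ball1 P CB (dimp C) u -> Yspan P (dimq C) eps -> `|eps| <= d ->
    (err C (theta0 C) u eps <= (c5 * d)%:E)%E.

Definition growth_bound (CB k1 k2 : R) (C : config P) : Prop :=
  forall u eps, ball1 P CB (dimp C) u -> Yspan P (dimq C) eps ->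
    (err C (theta0 C) u eps <= (k1 + k2 * `|eps|)%:E)%E.

End statement.

(* Main.v *)
Require Import Defs.
From mathcomp Require Import all_boot all_order all_algebra.
From mathcomp Require Import all_classical all_reals all_analysis.
From mathcomp Require Import measurable_realfun ring lra.

Import Order.TTheory GRing.Theory Num.Theory.
Import numFieldNormedType.Exports.

(** The minimizer does at least as well as the reference parameter, so that
everything is an estimate of the loss of the reference network at noise
standard deviation d^3.

The network sees its input m only through the vector A_pq^* m.  Each layer
w -> S(w - Z w / L + b / L) almost contracts: soft thresholding is
nonexpansive, I - G / L is a contraction because the Gram matrix G is positive
semidefinite of norm at most L ([psd_contraction]), and replacing G by Z costs
a factor 1 + d / (N L) per layer, hence exp(d / L) over the N layers.  An
input noise eps thus moves the output by at most kappa |A_pq^* eps| with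
kappa = N exp(d / L) / L ([net_lipschitz]).  As the error without noise is at
most c5 d, the error with noise is at most c5 d + kappa |A_pq^* eps|.

The p coordinates of the Gaussian vector A_pq^* eps have variances
d^6 |P_q A psi_I|^2, whatever the dimension q of the noise is
([integral_noise_le]).  Moreover kappa is at most of order 1 / d: N grows
logarithmically, and L is at least the norm of G, which stays away from 0
because A is injective.  If p is bounded as d tends to 0, the noise therefore
contributes at most a term of order d^4 to the loss.

The dimension p is indeed bounded.  Unless |P_q A psi_I| > 1 / (3 c5), some
noise of norm at most d makes the data of u = 3 c5 d psi_I vanish; the network
then returns the same output for u as for 0, which contradicts the bound c5 d
on its error ([wimage_lower_bound]).  On the other hand |A psi_I| is not
bounded away from 0 ([exists_small_wavelet_image]), because A^*A is a
convolution: |A psi_I|^2 is at most the integral of |K| times the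
autocorrelation of |psi_I|, a function bounded by 1 and supported in a
neighborhood of 0 which shrinks as the scale of psi_I gets finer, and K is
integrable near 0.  For the latter, the product of |K| with the
autocorrelation of one fixed wavelet is integrable, and this autocorrelation is
bounded below near 0 by a quantitative form of the Steinhaus theorem
([overlap_near0]).

The convergence in mean follows from f <= c / 2 + f^2 / (2 c), used with
c = d ([integral_le_second_moment]). *)

Set Implicit Arguments.
Unset Strict Implicit.

Local Open Scope classical_set_scope.
Local Open Scope ring_scope.

(** * Translations of the line and of the plane *)

Section shifts.
Context {R : realType}.

Lemma leb1_shift (b : R) (A : set (measurableTypeR R)) : measurable A ->
  leb1 ((fun x : measurableTypeR R => x + b : measurableTypeR R) @^-1` A) = leb1 A.
Proof.
have mshift : measurable_fun setT (fun x : measurableTypeR R => x + b : measurableTypeR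
  R).
  exact: (@measurable_funD _ _ _ _ (fun x : measurableTypeR R => x) (cst b)).
move=> mA; rewrite /leb1 /=.
have := @lebesgue_measure_unique R
  (pushforward lebesgue_measure (fun x : measurableTypeR R => x + b : measurableTypeR R)).
move=> /(_ mshift _ A mA) /= H; apply/esym/H => _ [[u v] _ <-].
rewrite /pushforward (_ : _ @^-1` _ = `]u - b, v - b]%classic).
  rewrite !lebesgue_measure_itv/= !lte_fin; have [uv|uv] := ltP u v.
    by rewrite ltrD2r uv -!EFinD; congr EFin; ring.
  by rewrite ltrD2r ltNge uv.
by apply/seteqP; split=> x /=; rewrite !in_itv /= ltrBlDr lerBrDr.
Qed.

(** Dominated convergence for the indicators of the [F n]. *)
Lemma measure_cvg0 d (T : measurableType d) (mu : {measure set T -> \bar R})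
    (A : set T) (F : nat -> set T) :
  measurable A -> (mu A < +oo)%E -> (forall n, measurable (F n)) ->
  (forall n, F n `<=` A) -> (forall x, A x -> \forall n \near \oo, ~ F n x) ->
  mu (F n) @[n --> \oo] --> 0%E.
Proof.
move=> mA Aoo mF FA Fx.
have iA : mu.-integrable setT (EFin \o \1_A : T -> \bar R).
  apply/integrableP; split; first exact/measurable_EFinP.
  under eq_integral do rewrite /= ger0_norm ?ler0n//.
  by rewrite integral_indic// setIT.
pose f_ n : T -> \bar R := EFin \o \1_(F n).
have mf_ n : measurable_fun setT (f_ n) by exact/measurable_EFinP.
have H n : (\int[mu]_x f_ n x = mu (F n))%E by rewrite integral_indic// setIT.
have f_f : {ae mu, forall x, setT x -> f_ ^~ x @ \oo --> (cst 0%E : T -> \bar R) x}.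
  apply: aeW => x _; apply/(@cvg_ballP _ (\bar R)) => e e0.
  have [Ax|nAx] := pselect (A x); last first.
    near=> n; rewrite /f_ /= indicE memNset; first exact: ballxx.
    by move=> /FA.
  have := Fx _ Ax; apply: filterS => n nF.
  by rewrite /f_ /= indicE memNset//; exact: ballxx.
have f_g : {ae mu, forall x n, setT x -> (`|f_ n x| <= (EFin \o \1_A : T -> \bar R) x)%E}.
  apply: aeW => x n _ /=; rewrite lee_fin !indicE ger0_norm//.
  have [/set_mem/FA/mem_set->//|_] := boolP (x \in F n).
  by rewrite ler_nat.
have [_ _] := dominated_convergence measurableT mf_ (measurable_cst _) f_f iA f_g.
by rewrite integral0; under eq_fun do rewrite H.
Unshelve. all: by end_near. Qed.

Lemma ge0_cvge0P {I : Type} {F : set_system I} {FF : Filter F} (u : I -> \bar R) :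
  (forall n, 0 <= u n)%E ->
  u n @[n --> F] --> 0%E <->
  (forall e : R, 0 < e -> \forall n \near F, (u n <= e%:E)%E).
Proof.
move=> u0; split=> [/fine_cvgP[ufin /cvgrPdist_le uc] e e0|H].
  apply: filterS2 ufin (uc _ e0) => n ufin; rewrite sub0r normrN.
  by rewrite ger0_norm ?fine_ge0// -lee_fin fineK.
apply/fine_cvgP; split.
  have := H 1 ltr01; apply: filterS => n un.
  by rewrite ge0_fin_numE// (le_lt_trans un) ?ltry.
apply/cvgrPdist_le => e e0; have := H _ e0; apply: filterS => n un.
rewrite sub0r normrN ger0_norm ?fine_ge0// -lee_fin fineK//.
by rewrite ge0_fin_numE// (le_lt_trans un) ?ltry.
Qed.

(** The set [A] is enclosed in an open set [U] of nearly the same measure.  A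
point [x] of [A] whose translate leaves [A] either has its translate in
[U `\` A], a set of small measure, or outside [U], which eventually does not
happen since [U] is open. *)
Lemma leb1_shift_diff_cvg0 (A : set (measurableTypeR R)) (b : nat -> R) :
  measurable A -> (leb1 A < +oo)%E -> b n @[n --> \oo] --> (0 : R) ->
  leb1 (A `&` [set x | ~ A (x + b n)]) @[n --> \oo] --> 0%E.
Proof.
move=> mA Aoo b0.
have mS (B : set (measurableTypeR R)) s : measurable B ->
    measurable [set x : measurableTypeR R | B (x + s)].
  move=> mB; rewrite -[X in measurable X]setTI.
  exact: (@measurable_funD _ _ _ _ (fun x : measurableTypeR R => x) (cst s)).
have mSC (B : set (measurableTypeR R)) s : measurable B ->
    measurable [set x : measurableTypeR R | ~ B (x + s)].
  by move=> mB; exact: (mS (~` B) s (measurableC mB)).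
apply/ge0_cvge0P => // e e0.
have e20 : 0 < e / 2 by rewrite divr_gt0.
have [U [oU AU UA]] := lebesgue_regularity_outer mA Aoo e20.
have mU : measurable U by exact: open_measurable.
have : leb1 (A `&` [set x | ~ U (x + b n)]) @[n --> \oo] --> 0%E.
  apply: (@measure_cvg0 _ _ leb1 A) => //.
  - by move=> n; apply: measurableI => //; exact: mSC.
  - move=> x Ax.
    have : x + b n @[n --> \oo] --> x.
      by rewrite -[X in _ --> X]addr0; apply: cvgD => //; exact: cvg_cst.
    move=> /(_ U) h; have : nbhs x U by apply: open_nbhs_nbhs; split => //; exact: AU.
    by move=> /h hU; near=> n => -[_]; apply; near: n; exact: hU.
move=> /ge0_cvge0P -/(_ _ _ e20) H.
pose B1 n : set (measurableTypeR R) := A `&` [set x | ~ U (x + b n)].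
pose B2 n : set (measurableTypeR R) := [set x | (U `\` A) (x + b n)].
have mB1 n : measurable (B1 n) by apply: measurableI => //; exact: mSC.
have mB2 n : measurable (B2 n) by apply: mS; exact: measurableD.
near=> n; apply: (@le_trans _ _ (leb1 (B1 n) + leb1 (B2 n))%E).
  apply: le_trans (measureU2 _ (mB1 n) (mB2 n)).
  apply: le_measure; rewrite ?inE.
  - by apply: measurableI => //; exact: mSC.
  - exact: measurableU.
  - move=> x [Ax nA]; have [Ux|nUx] := pselect (U (x + b n)); first by right.
    by left.
rewrite (splitr e) EFinD; apply: leeD.
  by near: n; apply: H => n; exact: measure_ge0.
rewrite (_ : leb1 (B2 n) = leb1 (U `\` A)); first exact: ltW.
by rewrite -(leb1_shift (b n) (measurableD mU mA)).
Unshelve. all: by end_near. Qed.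

End shifts.

Section plane_shifts.
Context {R : realType}.

Definition shift2 (s x : plane R) : plane R := (x.1 + s.1, x.2 + s.2).

Lemma measurable_shift1 (b : R) : measurable_fun setT
  (fun x : measurableTypeR R => x + b : measurableTypeR R).
Proof.
exact: (@measurable_funD _ _ _ _ (fun x : measurableTypeR R => x) (cst b)).
Qed.

Lemma measurable_shift2 : measurable_fun setT
  (fun z : plane R * plane R => shift2 z.1 z.2).
Proof.
have m1 : measurable_fun setT (fun z : plane R * plane R => z.1 : plane R)
  by exact: measurable_fst.
have m2 : measurable_fun setT (fun z : plane R * plane R => z.2 : plane R)
  by exact: measurable_snd.
apply: measurable_fun_pair => /=.
  apply: (@measurable_funD _ _ R setT (fun z : plane R * plane R => z.2.1) (fun z =>
    z.1.1)).
    exact: (measurableT_comp measurable_fst m2).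
  exact: (measurableT_comp measurable_fst m1).
apply: (@measurable_funD _ _ R setT (fun z : plane R * plane R => z.2.2) (fun z =>
  z.1.2)).
  exact: (measurableT_comp measurable_snd m2).
exact: (measurableT_comp measurable_snd m1).
Qed.

Lemma measurable_shift2r (s : plane R) : measurable_fun setT (shift2 s).
Proof. exact: (measurable_fun_pair2 s measurable_shift2). Qed.

Local Open Scope ereal_scope.

Lemma integral_leb1_shift (b : R) (f : measurableTypeR R -> \bar R) :
  measurable_fun setT f -> (forall x, 0 <= f x) ->
  \int[leb1]_x f (x + b)%R = \int[leb1]_x f x.
Proof.
move=> mf f0.
have := @ge0_integral_pushforward _ _ _ _ R _ (measurable_shift1 b) leb1 setT f
  measurableT mf.
rewrite preimage_setT => <- //.
apply: eq_measure_integral => [|mS A mA _]; first exact: measurable_shift1.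
by rewrite -[RHS](leb1_shift b mA).
Qed.

Lemma integral_leb2 (f : plane R -> \bar R) : measurable_fun setT f ->
  (forall x, 0 <= f x) ->
  \int[leb2]_x f x = \int[leb1]_x1 \int[leb1]_x2 f (x1, x2).
Proof. by move=> mf f0; rewrite -(@fubini_tonelli1 _ _ _ _ _ leb1 leb1 f mf f0). Qed.

Lemma integral_leb2_shift (s : plane R) (f : plane R -> \bar R) :
  measurable_fun setT f -> (forall x, 0 <= f x) ->
  \int[leb2]_x f (shift2 s x) = \int[leb2]_x f x.
Proof.
move=> mf f0; rewrite !integral_leb2//;
  last exact: (measurableT_comp mf (measurable_shift2r s)).
rewrite -[RHS](@integral_leb1_shift s.1); first last.
- by move=> x; exact: integral_ge0.
- exact: (@measurable_fun_fubini_tonelli_F _ _ _ _ _ leb1 f mf f0).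
apply: eq_integral => x _.
rewrite -[RHS](@integral_leb1_shift s.2)//.
exact: (measurable_fun_pair2 _ mf).
Qed.

Lemma integral_leb2_indic (E : set (plane R)) : measurable E ->
  \int[leb2]_x (\1_E x)%:E = leb2 E.
Proof. by move=> mE; rewrite integral_indic// setIT. Qed.

Lemma leb2_shift (s : plane R) (E : set (plane R)) : measurable E ->
  leb2 (shift2 s @^-1` E) = leb2 E.
Proof.
move=> mE; have mE' : measurable (shift2 s @^-1` E).
  by rewrite -[X in measurable X]setTI; exact: measurable_shift2r.
rewrite -!integral_leb2_indic// -[RHS](@integral_leb2_shift s)//; exact/measurable_EFinP.
Qed.

Lemma leb2_ysection (E : set (plane R)) : measurable E ->
  leb2 E = \int[leb1]_y leb1 (ysection E y).
Proof.
by move=> mE; apply: (@product_measure_unique _ _ _ _ R leb1 leb1 (leb1 \x^ leb1)) =>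
  // A B mA mB;
  exact: product_measure2E.
Qed.

(** A translation of the plane is the composition of a horizontal and a vertical
one.  For each of these the one-dimensional statement holds on almost every
line, and dominated convergence integrates it. *)
Lemma leb2_shift_diff_cvg0 (E : set (plane R)) (s : nat -> plane R) :
  measurable E -> leb2 E < +oo ->
  (s n).1 @[n --> \oo] --> (0 : R)%R -> (s n).2 @[n --> \oo] --> (0 : R)%R ->
  leb2 (E `&` [set x | ~ E (shift2 (s n) x)]) @[n --> \oo] --> 0.
Proof.
move=> mE Eoo s10 s20.
pose D t : set (plane R) := E `&` [set x | ~ E (shift2 t x)].
have mS (F : set (plane R)) t : measurable F -> measurable (shift2 t @^-1` F).
  by move=> mF; rewrite -[X in measurable X]setTI; exact: measurable_shift2r.
have mD (t : plane R) : measurable (D t).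
  exact: (measurableI _ _ mE (mS _ _ (measurableC mE))).
have finsec (f : measurableTypeR R -> \bar R) : measurable_fun setT f ->
    (forall x, 0 <= f x) -> \int[leb1]_x f x < +oo -> leb1.-integrable setT f.
  move=> mf f0 foo; apply/integrableP; split => //.
  by under eq_integral do rewrite gee0_abs//.
have cvg_sections (sec : set (plane R) -> measurableTypeR R -> set (measurableTypeR R))
    (t : nat -> plane R) (b : nat -> R) :
    (forall F, measurable F -> leb2 F = \int[leb1]_y leb1 (sec F y)) ->
    (forall F, measurable F -> measurable_fun setT (fun y => leb1 (sec F y))) ->
    (forall F y, measurable F -> measurable (sec F y)) ->
    (forall n y, sec (D (t n)) y = sec E y `&` [set x | ~ sec E y (x + b n)%R]) ->
    b n @[n --> \oo] --> (0 : R)%R -> leb2 (D (t n)) @[n --> \oo] --> 0.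
  move=> secE msec secm secD b0; under eq_fun do rewrite secE//.
  have iE : leb1.-integrable setT (fun y => leb1 (sec E y)).
    by apply: finsec => //; [exact: msec|rewrite -secE].
  have mf n : measurable_fun setT (fun y => leb1 (sec (D (t n)) y)) by exact: msec.
  have f_f : {ae leb1, forall y, setT y ->
      leb1 (sec (D (t n)) y) @[n --> \oo] --> (cst 0 : _ -> \bar R) y}.
    have := integrable_ae measurableT iE; apply: filterS => y /(_ I) yfin _.
    have : leb1 (sec E y) < +oo by rewrite -ge0_fin_numE.
    move=> /(leb1_shift_diff_cvg0 (secm _ y mE))/(_ b0).
    by apply: cvg_trans; apply: near_eq_cvg; near=> n; rewrite secD.
  have f_g : {ae leb1, forall y n, setT y -> `|leb1 (sec (D (t n)) y)| <= leb1 (sec E y)}.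
    apply: aeW => y n _; rewrite gee0_abs//; apply: le_measure; rewrite ?inE.
    - exact: secm.
    - exact: secm.
    - by rewrite secD; exact: subIsetl.
  have [_ _] := dominated_convergence measurableT mf (measurable_cst _) f_f iE f_g.
  by rewrite integral0.
have c1 : leb2 (D ((s n).1, 0)%R) @[n --> \oo] --> 0.
  apply: (cvg_sections (fun F y => ysection F y) _ (fun n => (s n).1)) => //.
  - exact: leb2_ysection.
  - by move=> F mF; exact: measurable_fun_ysection.
  - by move=> F y mF; exact: measurable_ysection.
  - move=> n y; apply/seteqP; split=> x /=.
      by rewrite /ysection/= !inE /D /shift2 /= addr0.
    by rewrite /ysection/= !inE /D /shift2 /= addr0.
have c2 : leb2 (D (0, (s n).2)%R) @[n --> \oo] --> 0.
  apply: (cvg_sections (fun F y => xsection F y) _ (fun n => (s n).2)) => //.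
  - by move=> F mF; exact: measurable_fun_xsection.
  - by move=> F y mF; exact: measurable_xsection.
  - move=> n y; apply/seteqP; split=> x /=.
      by rewrite /xsection/= !inE /D /shift2 /= addr0.
    by rewrite /xsection/= !inE /D /shift2 /= addr0.
have c12 : leb2 (D ((s n).1, 0)%R) + leb2 (D (0, (s n).2)%R) @[n --> \oo] --> 0.
  by rewrite -[X in _ --> X]adde0; apply: cvgeD.
apply: squeeze_cvge c12; last exact: cvg_cst.
near=> n; rewrite measure_ge0/=.
rewrite -[X in _ + X](leb2_shift ((s n).1, 0)%R (mD _)).
apply: le_trans (measureU2 _ (mD _) (mS _ _ (mD _))).
apply: le_measure; rewrite ?inE; [exact: mD| |].
  exact: (measurableU _ _ (mD _) (mS _ _ (mD _))).
move=> x [Ex nEx]; have [E1|nE1] := pselect (E (shift2 ((s n).1, 0)%R x)); last by left.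
by right; split => //=; move: nEx; rewrite /shift2/= !addr0.
Unshelve. all: by end_near. Qed.

End plane_shifts.

(** * Autocorrelation and convolution forms *)

Section autocorrelation.
Context {R : realType}.
Local Open Scope ereal_scope.

(** The Steinhaus theorem, in quantitative form: [E] and its small translates
overlap on at least half the measure of [E]. *)
Lemma overlap_near0 (E : set (plane R)) :
  measurable E -> 0 < leb2 E -> leb2 E < +oo ->
  exists r h : R, [/\ (0 < r)%R, (0 < h)%R &
    forall s : plane R, (`|s.1| < r)%R -> (`|s.2| < r)%R ->
      h%:E <= leb2 (E `&` shift2 s @^-1` E)].
Proof.
move=> mE E0 Eoo.
have Efin : leb2 E \is a fin_num by rewrite ge0_fin_numE// measure_ge0.
pose m := fine (leb2 E).
have m0 : (0 < m)%R by rewrite /m fine_gt0// E0.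
apply: contrapT => /forallNP noh.
pose bad (n : nat) (s : plane R) :=
  [/\ (`|s.1| < n.+1%:R^-1)%R, (`|s.2| < n.+1%:R^-1)%R &
      leb2 (E `&` shift2 s @^-1` E) < (m / 2)%:E].
have /choice[s hs] : forall n, exists s, bad n s.
  move=> n; apply: contrapT => /forallNP nb; apply: (noh (n.+1%:R^-1)%R);
    exists (m / 2)%R.
  split; rewrite ?divr_gt0//.
  by move=> s s1 s2; rewrite leNgt; apply/negP => h; apply: (nb s).
have s0 (f : plane R -> R) : (forall n, `|f (s n)| < n.+1%:R^-1)%R ->
    f (s n) @[n --> \oo] --> (0 : R)%R.
  move=> fs; apply/cvgr0Pnorm_lt => e e0.
  near=> n; apply: lt_trans (fs n) _; near: n.
  exact: near_infty_natSinv_lt (PosNum e0).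
have := leb2_shift_diff_cvg0 mE Eoo (s0 fst (fun n => let: And3 a _ _ := hs n in a))
  (s0 snd (fun n => let: And3 _ a _ := hs n in a)).
move=> /ge0_cvge0P -/(_ (fun=> measure_ge0 _ _)) /(_ (m / 4)%R).
rewrite divr_gt0// => /(_ isT)[N _ /(_ N (leqnn N))/= HN].
have [_ _ hN] := hs N.
have mS (F : set (plane R)) : measurable F -> measurable (shift2 (s N) @^-1` F).
  by move=> mF; rewrite -[X in measurable X]setTI; exact: measurable_shift2r.
have : leb2 E <= (m / 2)%:E + (m / 4)%:E.
  apply: le_trans (leeD (ltW hN) HN).
  apply: le_trans (measureU2 _ _ _); last 2 first.
  - exact: (measurableI _ _ mE (mS _ mE)).
  - exact: (measurableI _ _ mE (mS _ (measurableC mE))).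
  apply: le_measure; rewrite ?inE//.
  - apply: measurableU.
      exact: (measurableI _ _ mE (mS _ mE)).
    exact: (measurableI _ _ mE (mS _ (measurableC mE))).
  - by move=> x Ex; have [?|?] := pselect (E (shift2 (s N) x)); [left|right].
rewrite -(fineK Efin) -EFinD lee_fin -/m; lra.
Unshelve. all: by end_near. Qed.

Definition autocorr (v : plane R -> R) (s : plane R) : \bar R :=
  \int[leb2]_x (v x * v (shift2 s x))%:E.

Section nonneg.
Variable v : plane R -> R.
Hypothesis mv : measurable_fun setT v.
Hypothesis v0 : forall x, (0 <= v x)%R.

Let mvs s : measurable_fun setT (fun x => v (shift2 s x)).
Proof. exact: (measurableT_comp mv (measurable_shift2r s)). Qed.

Lemma autocorr_ge0 s : 0 <= autocorr v s.
Proof. by apply: integral_ge0 => x _; rewrite lee_fin mulr_ge0. Qed.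

(** From 2 v(x) v(x + s) <= v(x)^2 + v(x + s)^2 and translation invariance. *)
Lemma autocorr_le s : autocorr v s <= \int[leb2]_x (v x ^+ 2)%:E.
Proof.
have mv2 : measurable_fun setT (fun x => (2^-1 * v x ^+ 2)%:E).
  by apply/measurable_EFinP/measurable_funM => //; exact: measurable_funX.
have half : \int[leb2]_x (v x ^+ 2)%:E =
    \int[leb2]_x (2^-1 * v x ^+ 2)%:E + \int[leb2]_x (2^-1 * v x ^+ 2)%:E.
  rewrite -ge0_integralD//; try by move=> x _; rewrite lee_fin mulr_ge0// sqr_ge0.
  by apply: eq_integral => x _; rewrite -EFinD; congr EFin; lra.
rewrite half -{2}(@integral_leb2_shift _ s)//; last first.
  by move=> x; rewrite lee_fin mulr_ge0// sqr_ge0.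
rewrite -ge0_integralD//; first last.
- apply/measurable_EFinP/measurable_funM => //; exact: measurable_funX.
- by move=> x _; rewrite lee_fin mulr_ge0// sqr_ge0.
- by move=> x _; rewrite lee_fin mulr_ge0// sqr_ge0.
apply: ge0_le_integral => //.
- by move=> x _; rewrite lee_fin mulr_ge0.
- by apply/measurable_EFinP/measurable_funM.
- apply: emeasurable_funD => //.
  apply/measurable_EFinP/measurable_funM => //; exact: measurable_funX.
- move=> x _; rewrite -EFinD lee_fin; set a := v x; set b := v _.
  have := sqr_ge0 (a - b); nra.
Qed.

(** A nonzero [v] is at least some c > 0 on a set of positive measure, whose
overlap with its small translates bounds the autocorrelation from below. *)
Lemma autocorr_near0 : 0 < \int[leb2]_x (v x ^+ 2)%:E < +oo ->
  exists r h : R, [/\ (0 < r)%R, (0 < h)%R &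
    forall s : plane R, (`|s.1| < r)%R -> (`|s.2| < r)%R -> h%:E <= autocorr v s].
Proof.
move=> /andP[I0 Ioo].
have mv2 : measurable_fun setT (fun x => (v x ^+ 2)%:E).
  by apply/measurable_EFinP; exact: measurable_funX.
pose E n : set (plane R) := [set x | (n.+1%:R^-1 <= v x)%R].
have mE n : measurable (E n).
  rewrite (_ : E n = v @^-1` `[(n.+1%:R^-1)%R, +oo[%classic).
    by rewrite -[X in measurable X]setTI; exact: mv.
  by apply/seteqP; split => x /=; rewrite in_itv/= andbT.
have [n En] : exists n, 0 < leb2 (E n).
  apply: contrapT => /forallNP En; move: I0; rewrite lt_neqAle => /andP[+ _].
  move/eqP; apply; apply/esym.
  rewrite (@ae_eq_integral _ _ _ leb2 setT (cst 0)) ?integral0//.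
  have : leb2.-negligible (\bigcup_n E n).
    apply: negligible_bigcup => k; exists (E k); split => //.
    by apply/eqP; rewrite eq_le measure_ge0 andbT leNgt; apply/negP/En.
  apply: negligibleS => x /= nx; have : (v x != 0)%R.
    by apply: contra_notN nx => /eqP -> _; rewrite expr0n.
  rewrite neq_lt ltNge v0/= => vx.
  have [k vk] : exists k, (k.+1%:R^-1 < v x)%R.
    have [k _ /(_ k (leqnn k)) hk] := near_infty_natSinv_lt (PosNum vx).
    by exists k.
  by exists k => //; exact: ltW.
have c0 : (0 < n.+1%:R^-1 :> R)%R by rewrite invr_gt0.
set c : R := n.+1%:R^-1%R in c0.
have c20 : (0 < c ^+ 2)%R by rewrite exprn_gt0.
have Eoo : leb2 (E n) < +oo.
  have : (c ^+ 2)%:E * leb2 (E n) <= \int[leb2]_x (v x ^+ 2)%:E.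
    rewrite -integral_leb2_indic// -ge0_integralZl//=; last 2 first.
    - exact/measurable_EFinP.
    - by rewrite lee_fin ltW.
    apply: ge0_le_integral => //.
    - by move=> x _; rewrite -EFinM lee_fin mulr_ge0// ltW.
    - by apply/measurable_EFinP/measurable_funM.
    - move=> x _; rewrite -EFinM lee_fin indicE; case: (boolP (x \in E n)) => /=.
        by rewrite inE mulr1 /E/= -/c => h; rewrite lerXn2r// ?nnegrE// ltW.
      by rewrite mulr0 sqr_ge0.
  move=> h; have := le_lt_trans h Ioo; rewrite !ltey; apply: contraNN => /eqP ->.
  by rewrite gt0_muley ?lte_fin.
have [r [h [r0 h0 H]]] := overlap_near0 (mE n) En Eoo.
exists r, (c ^+ 2 * h)%R; split => //; first exact: mulr_gt0.
move=> s s1 s2; have mI : measurable (E n `&` shift2 s @^-1` E n).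
  apply: measurableI => //.
  by rewrite -[X in measurable X]setTI; exact: measurable_shift2r.
apply: (@le_trans _ _ ((c ^+ 2)%:E * leb2 (E n `&` shift2 s @^-1` E n))).
  by rewrite EFinM lee_pmul2l//; exact: H.
rewrite -integral_leb2_indic// -ge0_integralZl//=; last 2 first.
- exact/measurable_EFinP.
- by rewrite lee_fin ltW.
apply: ge0_le_integral => //.
- by move=> x _; rewrite -EFinM lee_fin mulr_ge0// ltW.
- by apply/measurable_EFinP/measurable_funM.
- by apply/measurable_EFinP/measurable_funM.
- move=> x _; rewrite -EFinM lee_fin indicE; case: (boolP (x \in _)) => /=.
    by rewrite inE mulr1 => -[]; rewrite /E/= -/c expr2 => h1 h2; rewrite ler_pM// ltW.
  by rewrite mulr0 mulr_ge0.
Qed.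

End nonneg.
End autocorrelation.

Section convolution_form.
Context {R : realType}.
Local Open Scope ereal_scope.

Definition box (j : nat) : set (plane R) :=
  [set s | (`|s.1| <= 2^-1 ^+ j)%R /\ (`|s.2| <= 2^-1 ^+ j)%R].

Lemma measurable_box j : measurable (box j).
Proof.
have -> : box j = `[(- 2^-1 ^+ j)%R, (2^-1 ^+ j)%R]%classic `*` `[(- 2^-1 ^+ j)%R,
  (2^-1 ^+ j)%R]%classic.
  by apply/seteqP; split => x; rewrite /box/= !in_itv/= !ler_norml.
exact: measurableX.
Qed.

Lemma measurable_box_indic j :
  measurable_fun setT (fun s => (\1_(box j) s)%:E : \bar R).
Proof.
apply/measurable_EFinP; apply: measurable_indic; exact: measurable_box.
Qed.

Lemma exp_half_lt (r : R) : (0 < r)%R -> \forall j \near \oo, (2^-1 ^+ j < r)%R.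
Proof.
move=> r0; have := @cvg_expr R 2^-1;
  rewrite ger0_norm ?invr_ge0// invf_lt1// ltr1n => /(_ isT).
by move=> /cvgr0Pnorm_lt/(_ _ r0); apply: filterS => j;
  rewrite ger0_norm ?exprn_ge0 ?invr_ge0.
Qed.

(** The boxes shrink to the origin, a null set. *)
Lemma integral_box_cvg0 (g : plane R -> \bar R) :
  measurable_fun setT g -> (forall s, 0 <= g s) -> \int[leb2]_s g s < +oo ->
  \int[leb2]_s (g s * (\1_(box j) s)%:E) @[j --> \oo] --> 0.
Proof.
move=> mg g0 goo.
have ig : leb2.-integrable setT g.
  apply/integrableP; split => //.
  by under eq_integral do rewrite gee0_abs//.
pose f_ j s := g s * (\1_(box j) s)%:E.
have mf_ j : measurable_fun setT (f_ j).
  by apply: emeasurable_funM => //; exact: measurable_box_indic.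
have f_f : {ae leb2, forall s, setT s -> f_ ^~ s @ \oo --> (cst 0 : _ -> \bar R) s}.
  exists ([set 0%R] `*` [set 0%R]); split.
  - exact: measurableX.
  - have := @product_measure1E _ _ _ _ R leb1 leb1 [set 0%R] [set 0%R] (measurable_set1
      _) (measurable_set1 _).
    by rewrite /leb1/= lebesgue_measure_set1 mul0e.
  - move=> [s1 s2] /= ns; apply: contrapT => s0; apply: ns => _.
    have [e [e0 es]] : exists e : R, (0 < e)%R /\ ~ (`|s1| < e /\ `|s2| < e)%R.
      have [s10|s1n] := eqVneq s1 0%R; last first.
        by exists `|s1|%R; rewrite normr_gt0 s1n ltxx; split => // -[].
      have [s20|s2n] := eqVneq s2 0%R; first by case: s0.
      by exists `|s2|%R; rewrite normr_gt0 s2n ltxx; split => // -[].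
    apply: cvg_near_cst.
    have := exp_half_lt e0; apply: filterS => j je.
    rewrite /f_ indicE memNset ?mule0// => -[/= h1 h2].
    by apply: es; split; apply: le_lt_trans je.
have f_g : {ae leb2, forall s j, setT s -> `|f_ j s| <= g s}.
  apply: aeW => s j _; rewrite gee0_abs ?mule_ge0 ?lee_fin//.
  rewrite /f_ indicE; case: (_ \in _); rewrite ?mule1// mule0 //.
have [_ _] := dominated_convergence measurableT mf_ (measurable_cst _) f_f ig f_g.
by rewrite integral0.
Qed.

(** The integrand K(x - x') v(x) v(x') in the variables x and s = x' - x, with
[k s] = K(- s): integrating over x first exhibits the autocorrelation of [v].
Measurability is only known for this product, not for [k] itself. *)
Definition pair_density (k v : plane R -> R) (z : plane R * plane R) : R :=
  `|k z.2| * (v z.1 * v (shift2 z.2 z.1)).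

Section fixed_profile.
Variables k v : plane R -> R.
Hypothesis mv : measurable_fun setT v.
Hypothesis v0 : forall x, (0 <= v x)%R.
Hypothesis md : measurable_fun setT (pair_density k v).

Let mE : measurable_fun setT (EFin \o pair_density k v).
Proof. exact/measurable_EFinP. Qed.

Let d0 z : 0 <= (EFin \o pair_density k v) z.
Proof. by rewrite lee_fin !mulr_ge0. Qed.

Lemma integral_pair_density_fst s :
  \int[leb2]_x (pair_density k v (x, s))%:E = `|k s|%:E * autocorr v s.
Proof.
rewrite /autocorr -ge0_integralZl_EFin//.
- by move=> x _; rewrite lee_fin mulr_ge0.
- apply/measurable_EFinP/measurable_funM => //.
  exact: (measurableT_comp mv (measurable_shift2r s)).
Qed.

Lemma measurable_weighted_autocorr : measurable_fun setT (fun s => `|k s|%:E * autocorr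
  v s).
Proof.
have := @measurable_fun_fubini_tonelli_G _ _ _ _ R leb2 _ mE d0.
by apply: eq_measurable_fun => s _; rewrite -integral_pair_density_fst.
Qed.

Lemma integral_pair_density :
  \int[leb2]_x \int[leb2]_s (pair_density k v (x, s))%:E
  = \int[leb2]_s (`|k s|%:E * autocorr v s).
Proof.
rewrite (@fubini_tonelli _ _ _ _ R leb2 leb2 _ mE d0).
by apply: eq_integral => s _; rewrite -integral_pair_density_fst.
Qed.

End fixed_profile.

(** The finite integral for the fixed profile [v0] says that |k| is integrable
against the autocorrelation of [v0], hence near the origin.  The
autocorrelations of the [v j] are at most 1 and concentrate at the origin. *)
Lemma convolution_form_cvg0 (k v0 : plane R -> R) (v : nat -> plane R -> R) :
  measurable_fun setT v0 -> (forall x, (0 <= v0 x)%R) ->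
  0 < \int[leb2]_x (v0 x ^+ 2)%:E < +oo ->
  measurable_fun setT (pair_density k v0) ->
  \int[leb2]_x \int[leb2]_s (pair_density k v0 (x, s))%:E < +oo ->
  (forall j, measurable_fun setT (v j)) -> (forall j x, (0 <= v j x)%R) ->
  (forall j, \int[leb2]_x (v j x ^+ 2)%:E <= 1) ->
  (forall j, measurable_fun setT (pair_density k (v j))) ->
  (forall j x, v j x != 0%R -> (0 <= x.1 <= 2^-1 ^+ j)%R /\ (0 <= x.2 <= 2^-1 ^+ j)%R) ->
  \int[leb2]_x \int[leb2]_s (pair_density k (v j) (x, s))%:E @[j --> \oo] --> 0.
Proof.
move=> mv0 v00 v0fin md0 d0oo mv vge0 v1 md supp.
pose g s := `|k s|%:E * autocorr v0 s.
have mg : measurable_fun setT g by exact: measurable_weighted_autocorr.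
have g0 s : 0 <= g s by rewrite mule_ge0 ?lee_fin// autocorr_ge0.
have goo : \int[leb2]_s g s < +oo by rewrite -integral_pair_density.
have [r [h [r0 h0 H]]] := autocorr_near0 mv0 v00 v0fin.
have ih0 : (0 <= h^-1)%R by rewrite invr_ge0 ltW.
have c0 : h^-1%:E * \int[leb2]_s (g s * (\1_(box j) s)%:E) @[j --> \oo] --> 0.
  by rewrite -[X in _ --> X](mule0 h^-1%:E); apply: cvgeZl => //;
    exact: integral_box_cvg0.
apply: squeeze_cvge c0; last exact: cvg_cst.
near=> j; apply/andP; split.
  by apply: integral_ge0 => x _; apply: integral_ge0 => s _; rewrite lee_fin !mulr_ge0.
have mgb : measurable_fun setT (fun s => g s * (\1_(box j) s)%:E).
  by apply: emeasurable_funM => //; exact: measurable_box_indic.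
rewrite integral_pair_density// -ge0_integralZl_EFin//; last first.
  by move=> s _; rewrite mule_ge0// lee_fin.
apply: ge0_le_integral => //.
- by move=> s _; rewrite mule_ge0 ?lee_fin// autocorr_ge0.
- exact: measurable_weighted_autocorr.
- exact: emeasurable_funM.
move=> s _; rewrite indicE.
have [/set_mem sb|/negP nsb] := boolP (s \in box j).
  rewrite mule1 /g muleCA; apply: lee_wpmul2l; first by rewrite lee_fin.
  apply: (@le_trans _ _ 1); first exact: le_trans (autocorr_le _ _ _) (v1 j).
  rewrite -(@divff _ h) ?gt_eqF// mulrC EFinM.
  apply: lee_wpmul2l; rewrite ?lee_fin//; apply: H.
    by apply: le_lt_trans sb.1 _; near: j; exact: exp_half_lt.
  by apply: le_lt_trans sb.2 _; near: j; exact: exp_half_lt.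
rewrite mule0 mule0; suff -> : autocorr (v j) s = 0 by rewrite mule0.
rewrite /autocorr integral0_eq// => x _; congr EFin; apply/eqP.
rewrite mulf_eq0; apply: contra_notT nsb;
  rewrite negb_or => /andP[/supp[x1 x2] /supp[/= y1 y2]].
rewrite inE; move: x1 x2 y1 y2 => /andP[? ?] /andP[? ?] /andP[? ?] /andP[? ?].
by split; rewrite ler_norml; apply/andP; split; lra.
Unshelve. all: by end_near. Qed.

End convolution_form.

(** * Square-integrable functions on a domain *)

Section restricted_measure.
Local Open Scope ereal_scope.

(** The measure [mu] is the sum of its restrictions to [D] and to the complement
of [D], and the integrand on the right vanishes on the latter. *)
Lemma ge0_integral_mrestr d (T : measurableType d) (R : realType)
    (mu : {measure set T -> \bar R}) (D : set T) (mD : measurable D)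
    (f : T -> \bar R) :
  measurable_fun setT f -> (forall x, 0 <= f x) ->
  \int[mrestr mu mD]_x f x = \int[mu]_x (f x * (\1_D x)%:E).
Proof.
move=> mf f0.
have mfD : measurable_fun setT (fun x => f x * (\1_D x)%:E).
  by apply: emeasurable_funM => //; exact/measurable_EFinP.
have fD0 x : 0 <= f x * (\1_D x)%:E by rewrite mule_ge0// lee_fin.
have mC := measurableC mD.
rewrite (@eq_measure_integral _ _ _ _ (measure_add (mrestr mu mD) (mrestr mu mC)));
  last first.
  move=> A mA _; rewrite [RHS]measure_addE /mrestr -[in LHS](setIT A) -(setUv D) setIUr.
  apply: measureU; [exact: measurableI|exact: measurableI|].
  by rewrite setIACA setICr setI0.
rewrite ge0_integral_measure_add// [X in _ + X](_ : _ = 0) ?adde0.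
  apply: ae_eq_integral => //; exists (~` D); split => //.
    by rewrite /= /mrestr setICl measure0.
  by move=> x /= nx Dx; apply: nx => _; rewrite indicE mem_set// mule1.
rewrite (@ae_eq_integral _ _ _ _ _ (cst 0)) ?integral0//.
exists D; split => //; first by rewrite /= /mrestr setICr measure0.
move=> x /= nx; apply: contrapT => nDx; apply: nx => _.
by rewrite indicE memNset// mule0.
Qed.

End restricted_measure.

Section inner_product_L2.
Context {R : realType} (O : set (plane R)) (mO : measurable O).
Implicit Types f g h : L2 mO.

Lemma L2_mul_integrable f g :
  (mrestr leb2 mO).-integrable setT (EFin \o (fun x => f x * g x)).
Proof.
by apply/Lfun1_integrable; apply: Lfun2_mul_Lfun1; exact: LfunP.
Qed.

Lemma ipXC f g : ipX f g = ipX g f.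
Proof. by apply: eq_Rintegral => x _; rewrite mulrC. Qed.

Lemma ipX_linear c f g h : ipX (c *: f + g) h = c * ipX f h + ipX g h.
Proof.
rewrite /ipX -RintegralZl//; last exact: L2_mul_integrable.
rewrite -RintegralD//; last 2 first.
- rewrite (_ : _ \o _ = EFin \o (fun x => (c *: f) x * h x)).
    exact: L2_mul_integrable.
  by apply/funext => x /=; rewrite -mulrA.
- exact: L2_mul_integrable.
by apply: eq_Rintegral => x _; rewrite mulrA -mulrDl.
Qed.

Lemma ipX0l h : ipX (0 : L2 mO) h = 0.
Proof. by have := ipX_linear (-1) 0 0 h; rewrite scaler0 addr0; lra. Qed.

Lemma ipXZl c f h : ipX (c *: f) h = c * ipX f h.
Proof. by have := ipX_linear c f 0 h; rewrite addr0 ipX0l addr0. Qed.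

Lemma ipX_suml n (c : 'I_n -> R) (f : 'I_n -> L2 mO) h :
  ipX (\sum_(i < n) c i *: f i) h = \sum_(i < n) c i * ipX (f i) h.
Proof.
elim: n c f => [|n IH] c f; first by rewrite !big_ord0 ipX0l.
by rewrite !big_ord_recl ipX_linear IH.
Qed.

Lemma eqX_ipX f g h : eqX f g -> ipX f h = ipX g h.
Proof.
move=> fg; congr fine; apply: ae_eq_integral => //.
- by have /integrableP[] := L2_mul_integrable f h.
- by have /integrableP[] := L2_mul_integrable g h.
- by apply: filterS fg => x fgx _ /=; rewrite fgx.
Qed.

End inner_product_L2.

(** * Images of the wavelets at fine scales *)

(** The first wavelet of scale [j], supported in the corner square of side 2^-j. *)
Lemma windex_v00 (J0 j : nat) : (J0 <= j)%N ->
  windex J0 (4 ^ j) = ((j, Wv), (0%N, 0%N)).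
Proof.
move=> J0j; rewrite /windex ltn_exp2l// ltnNge J0j /=.
by rewrite trunc_expnK// subnn mod0n !div0n mod0n.
Qed.

Section wavelet_images.
Context {R : realType} {Y : completeNormedModType R} (P : problem Y).
Hypothesis hY : Y_hilbert P.
Hypothesis hX : X_orthonormal_wavelet_basis P.
Hypothesis hadj : A_adjoint P.
Hypothesis hconv : AA_convolutional P.

Local Open Scope ereal_scope.

Let k (s : plane R) : R := kerK P (- s.1, - s.2)%R.

Let v (I : nat) (x : plane R) : R := (`|wav P I x| * \1_(Omega P) x)%R.

Let mwav I : measurable_fun setT (wav P I : plane R -> R).
Proof. exact: measurable_funP. Qed.

Let mv I : measurable_fun setT (v I).
Proof.
apply: measurable_funM; first exact: measurableT_comp.
by apply: measurable_indic; exact: mOmega.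
Qed.

Let v0 I x : (0 <= v I x)%R.
Proof. by rewrite mulr_ge0. Qed.

Let v_norm I : \int[leb2]_x (v I x ^+ 2)%:E = 1.
Proof.
have [_ _ ort _] := hX.
have /integrableP[mw _] := L2_mul_integrable (wav P I) (wav P I).
have w0 x : 0 <= (wav P I x * wav P I x)%:E by rewrite lee_fin -expr2 sqr_ge0.
have : \int[mrestr leb2 (mOmega P)]_x (wav P I x * wav P I x)%:E = 1.
  have := ort I I; rewrite eqxx /ipX /Rintegral.
  by case: integral => //= [r ->|/esym/eqP|/esym/eqP]; rewrite ?oner_eq0.
rewrite ge0_integral_mrestr// => <-.
apply: eq_integral => x _; rewrite -EFinM /v exprMn real_normK ?num_real//.
by rewrite -!expr2 indicE; case: (_ \in _); rewrite ?expr1n// expr0n.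
Qed.

Let D I (z : plane R * plane R) : R :=
  (`|kerK P (z.1.1 - z.2.1, z.1.2 - z.2.2)| * (v I z.1 * v I z.2))%R.

Let DE I z : (D I z)%:E = `|((EFin \o conv_integrand P I I) \_ (Omega P `*` Omega P)) z|.
Proof.
rewrite patchE /D /v /conv_integrand !indicE.
case: ifPn => [/set_mem[/= xO yO]|nO].
  by rewrite !mem_set//= !normrM !mulr1 mulrA.
have [xO|xO] := boolP (z.1 \in Omega P); last by rewrite !(mulr0, mul0r)/= normr0.
have [yO|yO] := boolP (z.2 \in Omega P); last by rewrite !(mulr0, mul0r)/= normr0.
by case/negP: nO; rewrite inE; split; exact/set_mem.
Qed.

Let mOO : measurable (Omega P `*` Omega P).
Proof. by apply: measurableX; exact: mOmega. Qed.

Let mD I : measurable_fun setT (D I).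
Proof.
have mr : measurable_fun setT ((EFin \o conv_integrand P I I) \_ (Omega P `*` Omega P)).
  apply: (measurable_restrictT _ mOO).1.
  by have [int _] := hconv I I; have /integrableP[] := int.
apply/measurable_EFinP; rewrite (_ : _ \o _ =
  abse \o ((EFin \o conv_integrand P I I) \_ (Omega P `*` Omega P))).
  exact: measurableT_comp mr.
by apply/funext => z; rewrite /= DE.
Qed.

Let D0 I z : (0 <= D I z)%R.
Proof. by rewrite mulr_ge0// mulr_ge0. Qed.

Let pairE I x s : pair_density k (v I) (x, s) = D I (x, shift2 x s).
Proof.
rewrite /pair_density /D /k /shift2 /=; congr (`|kerK P _| * (_ * v I _))%R.
  by congr pair; ring.
by congr pair; ring.
Qed.

Let mpair I : measurable_fun setT (pair_density k (v I)).
Proof.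
apply: (eq_measurable_fun (fun z => D I (z.1, shift2 z.1 z.2))).
  by move=> [x s] _; rewrite pairE.
apply: (measurableT_comp (mD I)); apply: measurable_fun_pair => //.
exact: measurable_shift2.
Qed.

Let pair_int I : \int[leb2]_x \int[leb2]_s (pair_density k (v I) (x, s))%:E
  = \int[leb2 \x leb2]_(z in Omega P `*` Omega P) `|(conv_integrand P I I z)%:E|.
Proof.
rewrite [RHS]integral_mkcond.
rewrite (eq_integral (fun z => (D I z)%:E)); last first.
  by move=> z _; rewrite DE !patchE; case: ifP => // _; rewrite abse0.
rewrite (@fubini_tonelli1 _ _ _ _ _ leb2 leb2 (EFin \o D I)); last 2 first.
- exact/measurable_EFinP.
- by move=> z; rewrite lee_fin.
apply: eq_integral => x _; rewrite /fubini_F.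
rewrite -[RHS](@integral_leb2_shift _ x); last 2 first.
- apply/measurable_EFinP; exact: (measurable_fun_pair2 x (mD I)).
- by move=> z; rewrite lee_fin.
by apply: eq_integral => s _; rewrite pairE.
Qed.

Let pair_lty I : \int[leb2]_x \int[leb2]_s (pair_density k (v I) (x, s))%:E < +oo.
Proof.
by rewrite pair_int; have [int _] := hconv I I; have /integrableP[] := int.
Qed.

Let normA_le I : (`|A P (wav P I)| ^+ 2)%:E <=
  \int[leb2]_x \int[leb2]_s (pair_density k (v I) (x, s))%:E.
Proof.
have [_ _ nrm] := hY; have [int eqn] := hconv I I.
rewrite -nrm hadj ipXC eqn pair_int.
apply: (@le_trans _ _ `|\int[leb2 \x leb2]_(z in Omega P `*` Omega P) (conv_integrand P
  I I z)%:E|).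
  by rewrite -EFin_normr_Rintegral// lee_fin ler_norm.
by apply: le_abse_integral => //; have /integrableP[] := int.
Qed.

(** The squared norm of the image of a wavelet is its convolution form, which
tends to 0 along the wavelets supported in the corner squares. *)
Lemma exists_small_wavelet_image (e : R) : (0 < e)%R ->
  exists I, (`|A P (wav P I)| < e)%R.
Proof.
move=> e0; have [supp wavE _ _] := hX.
have vsupp j x : v (4 ^ (J0 P + j)) x != 0%R ->
    (0 <= x.1 <= 2^-1 ^+ j)%R /\ (0 <= x.2 <= 2^-1 ^+ j)%R.
  rewrite /v mulf_eq0 negb_or normr_eq0 wavE windex_v00 ?leq_addr// => /andP[+ _].
  rewrite /wavelet /wtensor /= !subr0 !mulf_eq0 !negb_or => /andP[_ /andP[ph ps]].
  have c0 : (0 < 2 ^+ (J0 P + j) :> R)%R by rewrite exprn_gt0.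
  have c1 : (2 ^+ j <= 2 ^+ (J0 P + j) :> R)%R by rewrite ler_weXn2l// ?ler1n// leq_addl.
  have inbox (t : R) : (0 <= 2 ^+ (J0 P + j) * t <= 1)%R -> (0 <= t <= 2^-1 ^+ j)%R.
    rewrite pmulr_rge0// => /andP[t0 t1]; rewrite t0/= exprVn.
    rewrite -[X in (_ <= X)%R]mul1r ler_pdivlMr ?exprn_gt0// mulrC.
    by apply: le_trans t1; rewrite ler_wpM2r.
  split; apply: inbox; apply: contraTT isT => nx.
    by have [px _] := supp _ nx; rewrite px eqxx in ph.
  by have [_ px] := supp _ nx; rewrite px eqxx in ps.
have cv : \int[leb2]_x \int[leb2]_s (pair_density k (v (4 ^ (J0 P + j))) (x, s))%:E
    @[j --> \oo] --> 0.
  apply: (@convolution_form_cvg0 R k (v (4 ^ J0 P))) => //.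
  - by rewrite v_norm lte01 ltry.
  - by move=> j; rewrite v_norm.
have e20 : (0 < e ^+ 2 / 2)%R by rewrite divr_gt0// exprn_gt0.
have ge0 j : 0 <= \int[leb2]_x \int[leb2]_s (pair_density k (v (4 ^ (J0 P + j))) (x,
  s))%:E.
  exact: le_trans (normA_le _); rewrite lee_fin sqr_ge0.
have /(ge0_cvge0P ge0)/(_ _ e20)[j _ /(_ j (leqnn j)) /= hj] := cv.
exists (4 ^ (J0 P + j))%N; rewrite -(@ltr_pXn2r _ 2)// ?nnegrE// ?ltW//.
have := le_trans (normA_le _) hj; rewrite lee_fin; nra.
Qed.

End wavelet_images.

(** * Euclidean norm and unrolled iterations *)

Section cauchy_schwarz.
Context {R : realType} {V : lmodType R} (B : V -> V -> R).
Hypothesis Blin : forall c x y z, B (c *: x + y) z = c * B x z + B y z.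
Hypothesis Bsym : forall x y, B x y = B y x.
Hypothesis Bge0 : forall x, 0 <= B x x.

Lemma form0l z : B 0 z = 0.
Proof. by have := Blin (-1) 0 0 z; rewrite scaler0 addr0; lra. Qed.

Lemma formZl c x z : B (c *: x) z = c * B x z.
Proof. by have := Blin c x 0 z; rewrite addr0 form0l addr0. Qed.

Lemma formDl x y z : B (x + y) z = B x z + B y z.
Proof. by have := Blin 1 x y z; rewrite scale1r mul1r. Qed.

Lemma formZr c x z : B z (c *: x) = c * B z x.
Proof. by rewrite Bsym formZl Bsym. Qed.

Lemma formDr x y z : B z (x + y) = B z x + B z y.
Proof. by rewrite Bsym formDl !(Bsym z). Qed.

Lemma form_suml n (c : 'I_n -> R) (f : 'I_n -> V) z :
  B (\sum_(i < n) c i *: f i) z = \sum_(i < n) c i * B (f i) z.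
Proof.
elim: n c f => [|n IH] c f; first by rewrite !big_ord0 form0l.
by rewrite !big_ord_recl Blin IH.
Qed.

Lemma form_sumr n (c : 'I_n -> R) (f : 'I_n -> V) z :
  B z (\sum_(i < n) c i *: f i) = \sum_(i < n) c i * B z (f i).
Proof. by rewrite Bsym form_suml; apply: eq_bigr => i _; rewrite Bsym. Qed.

(** Stated for a semidefinite form, because it is also applied to the Gram matrix. *)
Lemma cauchy_schwarz x y : B x y ^+ 2 <= B x x * B y y.
Proof.
have H t : 0 <= B x x + 2 * t * B x y + t ^+ 2 * B y y.
  have := Bge0 (x + t *: y); rewrite formDl !formDr !(formZl, formZr).
  by rewrite (Bsym y x); lra.
have := Bge0 y; rewrite le_eqVlt => /orP[/eqP y0|y0].
  have [-> |xy] := eqVneq (B x y) 0; first by rewrite expr0n/= mulr_ge0.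
  have := H (- (B x x + 1) / (2 * B x y)); rewrite -y0 mulr0 addr0.
  rewrite (_ : 2 * _ * _ = - (B x x + 1)); first by lra.
  by field; rewrite xy.
have := H (- B x y / B y y).
rewrite (_ : _ + _ + _ = (B x x * B y y - B x y ^+ 2) / B y y); last first.
  by field; rewrite gt_eqF.
by rewrite pmulr_lge0 ?invr_gt0// subr_ge0.
Qed.

End cauchy_schwarz.

Section euclidean_norm.
Context {R : realType}.

Definition dotv p (u w : 'cV[R]_p) : R := \sum_(i < p) u i 0 * w i 0.

Definition normv p (w : 'cV[R]_p) : R := Num.sqrt (dotv w w).

Lemma dotv_lin p c (x y z : 'cV[R]_p) : dotv (c *: x + y) z = c * dotv x z + dotv y z.
Proof.
rewrite /dotv mulr_sumr -big_split/=; apply: eq_bigr => i _.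
by rewrite !mxE mulrDl mulrA.
Qed.

Lemma dotvC p (x y : 'cV[R]_p) : dotv x y = dotv y x.
Proof. by apply: eq_bigr => i _; rewrite mulrC. Qed.

Lemma dotv_ge0 p (x : 'cV[R]_p) : 0 <= dotv x x.
Proof. by apply: sumr_ge0 => i _; rewrite -expr2 sqr_ge0. Qed.

Lemma normv_ge0 p (x : 'cV[R]_p) : 0 <= normv x.
Proof. exact: sqrtr_ge0. Qed.

Lemma sqr_normv p (x : 'cV[R]_p) : normv x ^+ 2 = dotv x x.
Proof. by rewrite sqr_sqrtr// dotv_ge0. Qed.

Lemma dotv_le p (x y : 'cV[R]_p) : dotv x y <= normv x * normv y.
Proof.
apply: (le_trans (ler_norm _)); rewrite -ler_sqr ?nnegrE ?mulr_ge0 ?normv_ge0//.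
rewrite real_normK ?num_real// exprMn !sqr_normv.
exact: cauchy_schwarz (@dotv_lin p) (@dotvC p) (@dotv_ge0 p) _ _.
Qed.

Lemma normvD p (x y : 'cV[R]_p) : normv (x + y) <= normv x + normv y.
Proof.
rewrite -ler_sqr ?nnegrE ?addr_ge0 ?normv_ge0//.
have lin := @dotv_lin p; have sym := @dotvC p.
rewrite sqr_normv sqrrD !sqr_normv (formDl lin) !(formDr lin sym) (sym y x).
by have := dotv_le x y; lra.
Qed.

Lemma normvZ p c (x : 'cV[R]_p) : normv (c *: x) = `|c| * normv x.
Proof.
have lin := @dotv_lin p; have sym := @dotvC p.
by rewrite /normv (formZl lin) (formZr lin sym) mulrA -expr2 sqrtrM ?sqr_ge0// sqrtr_sqr.
Qed.

Lemma ler_normv p (x y : 'cV[R]_p) : (forall i, `|x i 0| <= `|y i 0|) ->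
  normv x <= normv y.
Proof.
move=> xy; rewrite ler_wsqrtr//; apply: ler_sum => i _.
by rewrite -!expr2 -[leLHS]real_normK ?num_real// -[leRHS]real_normK ?num_real//
  lerXn2r ?nnegrE.
Qed.

Lemma coord_le_normv p (x : 'cV[R]_p) i : `|x i 0| <= normv x.
Proof.
rewrite -sqrtr_sqr ler_wsqrtr// /dotv (bigD1 i)//= -expr2 lerDl.
by apply: sumr_ge0 => j _; rewrite -expr2 sqr_ge0.
Qed.

Lemma coordB_le_normv p (x y : 'cV[R]_p) i : `|x i 0 - y i 0| <= normv (x - y).
Proof. by have := coord_le_normv (x - y) i; rewrite !mxE. Qed.

Lemma truncE p (w : nat -> R) (i : 'I_p) : trunc p w i 0 = w i.
Proof. by rewrite mxE. Qed.

Lemma nneseries_finite_support (f : nat -> \bar R) p : (forall k, 0 <= f k)%E ->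
  (forall k, (p <= k)%N -> f k = 0%E) ->
  (\sum_(k <oo) f k = \sum_(k < p) f k)%E.
Proof.
move=> f0 fp; rewrite (nneseries_split 0 p)// add0n eseries0 ?adde0 ?big_mkord//.
by move=> k pk _; exact: fp.
Qed.

Lemma zext_ge p (w : 'cV[R]_p) k : (p <= k)%N -> zext w k = 0.
Proof. by move=> pk; rewrite /zext insubN// -leqNgt. Qed.

Lemma zext_ord p (w : 'cV[R]_p) (i : 'I_p) : zext w i = w i 0.
Proof. by rewrite /zext valK. Qed.

Lemma zext_trunc p (w : nat -> R) : (forall k, (p <= k)%N -> w k = 0) ->
  zext (trunc p w) = w.
Proof.
move=> w0; apply/funext => k; have [pk|kp] := leqP p k; first by rewrite zext_ge ?w0.
by rewrite (zext_ord (trunc p w) (Ordinal kp)) mxE.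
Qed.

Lemma zextB p (u w : 'cV[R]_p) k : zext (u - w) k = zext u k - zext w k.
Proof. by rewrite /zext; case: insub => [i|]; rewrite ?mxE ?subr0. Qed.

Lemma l2norm_zext p (w : 'cV[R]_p) : l2norm (zext w) = (normv w)%:E.
Proof.
rewrite /l2norm Lnorm_counting// (@nneseries_finite_support _ p); last 2 first.
- by move=> k; rewrite poweR_ge0.
- by move=> k pk; rewrite /= zext_ge// normr0 powR0//.
rewrite (eq_bigr (fun i : 'I_p => (w i 0 * w i 0)%:E)); last first.
  by move=> i _; rewrite /= zext_ord -expr2 -[in RHS]real_normK ?num_real// powR_mulrn//.
rewrite sumEFin poweR_EFin powR12_sqrt //; exact: dotv_ge0.
Qed.

Lemma l1norm_finite_support p (w : nat -> R) : (forall k, (p <= k)%N -> w k = 0) ->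
  l1norm w = (\sum_(k < p) `|w k|)%:E.
Proof.
move=> w0; rewrite /l1norm Lnorm_counting// invr1 poweRe1; last first.
  by apply: nneseries_ge0 => k _ _; rewrite poweR_ge0.
rewrite (@nneseries_finite_support _ p); last 2 first.
- by move=> k; rewrite poweR_ge0.
- by move=> k pk; rewrite /= w0// normr0 powR0//.
rewrite -sumEFin; apply: eq_bigr => i _; by rewrite poweRe1.
Qed.

(** The Cauchy-Schwarz inequality for the form of [G] gives
|G w|^2 <= L <w, G w>, and then |w - G w / L|^2 <= |w|^2. *)
Lemma psd_contraction p (G : 'M[R]_p) (L : R) : 0 < L ->
  (forall x y, dotv x (G *m y) = dotv y (G *m x)) ->
  (forall x, 0 <= dotv x (G *m x)) ->
  (forall x, normv (G *m x) <= L * normv x) ->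
  forall w, normv (w - L^-1 *: (G *m w)) <= normv w.
Proof.
move=> L0 Gsym Gpsd GL w.
have lin := @dotv_lin p; have sym := @dotvC p.
pose Bf x y := dotv x (G *m y).
have Blin c x y z : Bf (c *: x + y) z = c * Bf x z + Bf y z by exact: lin.
set g := G *m w.
have CS : dotv g g ^+ 2 <= dotv g (G *m g) * dotv w g.
  exact: (cauchy_schwarz Blin Gsym Gpsd g w).
have gg : dotv g (G *m g) <= L * dotv g g.
  apply: (le_trans (dotv_le _ _)); rewrite -sqr_normv expr2 mulrCA.
  by rewrite ler_wpM2l ?normv_ge0.
have key : dotv g g <= L * dotv w g.
  have := dotv_ge0 g; rewrite le_eqVlt => /orP[/eqP <-|g0].
    by rewrite mulr_ge0 ?Gpsd// ltW.
  rewrite -(ler_pM2l g0) -expr2; apply: (le_trans CS).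
  by rewrite mulrA [_ * L]mulrC ler_wpM2r// Gpsd.
rewrite -ler_sqr ?nnegrE ?normv_ge0// !sqr_normv -scaleNr.
rewrite (formDl lin) !(formDr lin sym) !(formZl lin) !(formZr lin sym) (sym g w).
rewrite -subr_ge0.
rewrite (_ : _ - _ = L^-1 ^+ 2 * (2 * (L * dotv w g) - dotv g g));
  last by field; rewrite gt_eqF.
have := Gpsd w; rewrite -/g => wg.
by rewrite mulr_ge0 ?sqr_ge0//; have := mulr_ge0 (ltW L0) wg; lra.
Qed.

Lemma soft_cases (b x : R) :
  [\/ x < - b /\ soft b x = x + b, (- b <= x <= b) /\ soft b x = 0
    | b < x /\ soft b x = x - b].
Proof.
rewrite /soft ler_norml; case: (ltP x (- b)) => h1; first by constructor 1.
by case: (leP x b) => h2 /=; [constructor 2|constructor 3].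
Qed.

Lemma soft_nonexpansive (b x y : R) : 0 <= b -> `|soft b x - soft b y| <= `|x - y|.
Proof.
move=> b0.
have [[h1 ->]|[/andP[h1 h1'] ->]|[h1 ->]] := soft_cases b x;
have [[h2 ->]|[/andP[h2 h2'] ->]|[h2 ->]] := soft_cases b y;
by case: (ger0P (x - y)) => xy; rewrite ler_norml; apply/andP; split; lra.
Qed.

(** Each layer multiplies the distance by at most [r] and adds the distance of
the two inputs divided by [L]. *)
Lemma unroll_lipschitz p (M : nat -> 'M[R]_p) (L l r : R) (b b' w0 : 'cV[R]_p) N :
  0 < L -> 0 <= l -> 1 <= r ->
  (forall n, (1 <= n <= N)%N ->
    forall w, normv (w - L^-1 *: (M n *m w)) <= r * normv w) ->
  normv (unroll M L l b w0 N - unroll M L l b' w0 N)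
    <= N%:R * r ^+ N * (L^-1 * normv (b - b')).
Proof.
move=> L0 l0 r1 Mr; have r0 : 0 <= r by lra.
set D := L^-1 * _.
have D0 : 0 <= D by rewrite mulr_ge0 ?normv_ge0// invr_ge0 ltW.
suff: forall n, (n <= N)%N ->
    normv (unroll M L l b w0 n - unroll M L l b' w0 n) <= n%:R * r ^+ n * D.
  by apply.
elim=> [|n IH] nN /=.
  by rewrite subrr -(scale0r 0) normvZ normr0 !mul0r.
set u := unroll _ _ _ _ _ n; set u' := unroll _ _ _ _ _ n.
pose x (v c : 'cV[R]_p) : 'cV[R]_p := v - L^-1 *: (M n.+1 *m v) + L^-1 *: c.
apply: (@le_trans _ _ (normv (x u b - x u' b'))).
  rewrite -/(x u b) -/(x u' b'); apply: ler_normv => i; move: (x u b) (x u' b') => y y'.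
  by rewrite !mxE; apply: soft_nonexpansive; rewrite divr_ge0// mulr_ge0// ltW.
have -> : x u b - x u' b' =
    (u - u') - L^-1 *: (M n.+1 *m (u - u')) + L^-1 *: (b - b').
  rewrite /x mulmxBr !scalerBr [in LHS]opprD addrACA; congr (_ + _).
  by rewrite opprD opprK addrACA [in RHS]opprB [- _ + _]addrC.
apply: (le_trans (normvD _ _)); rewrite normvZ ger0_norm ?invr_ge0 ?(ltW L0)//.
apply: (le_trans (lerD (Mr n.+1 _ _) (lexx _))); first by rewrite /= nN.
have IHn := IH (ltnW nN).
apply: (@le_trans _ _ (r * (n%:R * r ^+ n * D) + r ^+ n.+1 * D)).
  apply: lerD; first by rewrite ler_wpM2l.
  rewrite -/D -[X in X <= _]mul1r ler_wpM2r//.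
  exact: exprn_ege1.
by rewrite -natr1 exprS le_eqVlt; apply/orP; left; apply/eqP; ring.
Qed.

End euclidean_norm.

(** * Second moments of Gaussian linear forms *)

Section gaussian_moments.
Context {R : realType}.
Local Open Scope ereal_scope.

(** The density of the normal law is its Radon-Nikodym derivative. *)
Lemma ge0_integral_normal_prob (s : R) (f : measurableTypeR R -> \bar R) :
  measurable_fun setT f -> (forall x, 0 <= f x) ->
  \int[normal_prob 0 s]_x f x
  = \int[leb1]_x (f x * (normal_pdf 0 s x)%:E).
Proof.
move=> mf f0; have dom := normal_prob_dominates 0 s.
have mpdf : measurable_fun setT (fun x : measurableTypeR R => (normal_pdf 0 s x)%:E).
  by apply/measurable_EFinP; exact: measurable_normal_pdf.
have iRN := Radon_Nikodym_SigmaFinite.f_integrable dom.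
have mRN : measurable_fun setT (Radon_Nikodym_SigmaFinite.f (normal_prob 0 s)
  lebesgue_measure).
  by have /integrableP[] := iRN.
rewrite -(Radon_Nikodym_SigmaFinite.change_of_variables dom f0 measurableT mf).
apply: ae_eq_integral => //.
- exact: emeasurable_funM.
- exact: emeasurable_funM.
apply: ae_eqe_mul2l; apply: integral_ae_eq => // E _ mE.
by rewrite -Radon_Nikodym_SigmaFinite.f_integral.
Qed.

Lemma integral_leb1N (f : measurableTypeR R -> \bar R) :
  measurable_fun setT f -> (forall x, 0 <= f x) ->
  \int[leb1]_x f (- x)%R = \int[leb1]_x f x.
Proof.
move=> mf f0.
have mopp : measurable_fun setT (fun x : measurableTypeR R => (- x)%R : measurableTypeR
  R).
  exact: (@oppr_measurable R setT).
have := @ge0_integral_pushforward _ _ _ _ R _ mopp leb1 setT f measurableT mf.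
rewrite preimage_setT => <- //.
apply: eq_measure_integral => A mA _.
exact: lebesgue_measureN.
Qed.

Lemma normal_pdf_even (s x : R) : s != 0%R -> normal_pdf 0 s (- x) = normal_pdf 0 s x.
Proof. by move=> s0; rewrite normal_pdfE// /normal_fun !subr0 sqrrN. Qed.

Lemma integral_normal_prob_opp (s : R) (f : measurableTypeR R -> \bar R) : s != 0%R ->
  measurable_fun setT f -> (forall x, 0 <= f x) ->
  \int[normal_prob 0 s]_x f (- x)%R = \int[normal_prob 0 s]_x f x.
Proof.
move=> s0 mf f0.
have mopp : measurable_fun setT (fun x : measurableTypeR R => (- x)%R : measurableTypeR
  R).
  exact: (@oppr_measurable R setT).
have mfo := measurableT_comp mf mopp.
have mpdf : measurable_fun setT (fun x : measurableTypeR R => (normal_pdf 0 s x)%:E).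
  by apply/measurable_EFinP; exact: measurable_normal_pdf.
rewrite !ge0_integral_normal_prob//.
rewrite -[RHS]integral_leb1N; last 2 first.
- exact: emeasurable_funM.
- by move=> x; rewrite mule_ge0// lee_fin normal_pdf_ge0.
by apply: eq_integral => x _; rewrite normal_pdf_even.
Qed.

(** Since y exp(- y) <= 1, x^2 times the density of standard deviation s is at most
6 s^2 times the density of standard deviation 2 s, whose integral is 1. *)
Lemma normal_second_moment_le (s : R) : (0 < s)%R ->
  \int[normal_prob 0 s]_x ((x : R) ^+ 2)%:E <= (6 * s ^+ 2)%:E.
Proof.
move=> s0; have sn0 : s != 0%R by rewrite gt_eqF.
have s2n0 : (2 * s)%R != 0%R by rewrite mulf_neq0.
have msq : measurable_fun setT (fun x : measurableTypeR R => ((x : R) ^+ 2)%:E).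
  apply/measurable_EFinP; exact: (@measurable_funX _ _ _ _ (fun x : measurableTypeR R
    => x)).
have mpdf t : measurable_fun setT (fun x : measurableTypeR R => (normal_pdf 0 t x)%:E :
  \bar R).
  by apply/measurable_EFinP; exact: measurable_normal_pdf.
rewrite ge0_integral_normal_prob//; last by move=> x; rewrite lee_fin sqr_ge0.
apply: (@le_trans _ _ (\int[leb1]_x ((6 * s ^+ 2)%:E * (normal_pdf 0 (2 * s) x)%:E)));
  last first.
  rewrite ge0_integralZl_EFin//; last 2 first.
  - by move=> x _; rewrite lee_fin normal_pdf_ge0.
  - by rewrite mulr_ge0// sqr_ge0.
  by rewrite integral_normal_pdf mule1.
apply: ge0_le_integral => //.
- by move=> x _; rewrite mule_ge0 ?lee_fin ?sqr_ge0// normal_pdf_ge0.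
- exact: emeasurable_funM.
- by apply: emeasurable_funM => //; exact: mpdf.
move=> x _; rewrite -!EFinM lee_fin !normal_pdfE// /normal_fun subr0.
have -> : normal_peak (2 * s) = (normal_peak s / 2)%R.
  rewrite /normal_peak -invfM; congr (_^-1)%R.
  move: (@pi R) => c.
  have -> : ((2 * s) ^+ 2 * c *+ 2 = 2 ^+ 2 * (s ^+ 2 * c *+ 2))%R by ring.
  by rewrite sqrtrM ?sqr_ge0// sqrtr_sqr ger0_norm// mulrC.
have pk : (0 < normal_peak s)%R by rewrite normal_peak_gt0.
(* The difference of the two Gaussian exponents. *)
set y : R := (3 * x ^+ 2 / (8 * s ^+ 2))%R.
have e1 : (expR (- x ^+ 2 / (s ^+ 2 *+ 2)) =
  expR (- y) * expR (- x ^+ 2 / ((2 * s) ^+ 2 *+ 2)))%R.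
  by rewrite -expRD; congr expR; rewrite /y; field.
rewrite e1; set E := expR (- x ^+ 2 / ((2 * s) ^+ 2 *+ 2)).
have E0 : (0 < E)%R by exact: expR_gt0.
have yb : (y * expR (- y) <= 1)%R.
  rewrite expRN ler_pdivrMr ?expR_gt0// mul1r.
  by have := expR_ge1Dx y; lra.
have xE : (x ^+ 2 = 8 / 3 * s ^+ 2 * y)%R by rewrite /y; field.
rewrite xE.
set k : R := (s ^+ 2 * normal_peak s * E)%R.
have k0 : (0 <= k)%R by rewrite mulr_ge0 ?mulr_ge0 ?sqr_ge0 ?ltW.
apply: (@le_trans _ _ (8 / 3 * (k * (y * expR (- y))))%R).
  by rewrite le_eqVlt; apply/orP; left; apply/eqP; rewrite /k; ring.
apply: (@le_trans _ _ (3 * k)%R); last first.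
  by rewrite le_eqVlt; apply/orP; left; apply/eqP; rewrite /k; field.
by have : (k * (y * expR (- y)) <= k * 1)%R by [rewrite ler_wpM2l]; lra.
Qed.

End gaussian_moments.

Section gaussian_vectors.
Context {R : realType}.
Local Open Scope ereal_scope.

(** The cross term disappears on averaging over x and - x, by symmetry of the
normal law. *)
Lemma normal_affine_second_moment_le (s c y : R) : (0 < s)%R ->
  \int[normal_prob 0 s]_x ((x * c + y : R) ^+ 2)%:E <= (6 * s ^+ 2 * c ^+ 2 + y ^+ 2)%:E.
Proof.
move=> s0; have sn0 : s != 0%R by rewrite gt_eqF.
have msq (a b : R) : measurable_fun setT (fun x : measurableTypeR R => ((x * a + b : R)
  ^+ 2)%:E).
  apply/measurable_EFinP/measurable_funX; apply: measurable_funD => //.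
  exact: (@measurable_funM _ _ _ _ (fun x : measurableTypeR R => x)).
have ge0 (a b : R) (x : measurableTypeR R) : 0 <=
  ((x * a + b : R) ^+ 2)%:E by rewrite lee_fin sqr_ge0.
have m2 : measurable_fun setT (fun x : measurableTypeR R => ((x : R) ^+ 2)%:E).
  apply/measurable_EFinP; exact: (@measurable_funX _ _ _ _ (fun x : measurableTypeR R
    => x)).
have c20 : (0 <= 2 * c ^+ 2)%R by apply: mulr_ge0 => //; exact: sqr_ge0.
have y20 : (0 <= 2 * y ^+ 2)%R by apply: mulr_ge0 => //; exact: sqr_ge0.
set I := \int[normal_prob 0 s]_x _.
(* Twice the integral is the integral of the sum over x and - x. *)
have I2 : I + I = \int[normal_prob 0 s]_x ((2 * c ^+ 2)%:E * ((x : R) ^+ 2)%:E + (2 * y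
  ^+ 2)%:E).
  rewrite {2}/I -(integral_normal_prob_opp sn0 (msq c y) (ge0 c y)) -ge0_integralD//.
  - by apply: eq_integral => x _; rewrite -EFinM -!EFinD; congr EFin; ring.
  - apply: (eq_measurable_fun _ _ (msq (- c)%R y)).
    by move=> x _; rewrite mulNr mulrN.
have : I + I <= (2 * (6 * s ^+ 2 * c ^+ 2 + y ^+ 2))%:E.
  rewrite I2 ge0_integralD//; last 2 first.
  - by move=> x _; apply: mule_ge0; rewrite lee_fin ?sqr_ge0//; exact: c20.
  - exact: emeasurable_funM.
  rewrite ge0_integralZl_EFin//; last first.
  - by move=> x _; rewrite lee_fin sqr_ge0.
  rewrite integral_cst// [X in _ + _ * X](_ : _ = 1);
    last exact: (@probability_setT _ _ _ (normal_prob 0 s)).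
  rewrite mule1.
  have : (2 * c ^+ 2)%:E * \int[normal_prob 0 s]_x ((x : R) ^+ 2)%:E <=
    (2 * c ^+ 2)%:E * (6 * s ^+ 2)%:E.
    apply: lee_wpmul2l; first by rewrite lee_fin.
    exact: normal_second_moment_le.
  move=> h; apply: (le_trans (leeD h (lexx _))).
  by rewrite -EFinM -EFinD lee_fin; lra.
have I0 : 0 <= I by apply: integral_ge0.
case: I I0 {I2} => //= r; rewrite -EFinD !lee_fin; lra.
Qed.

Definition linform q (al : 'I_q -> R) (t : q.-tuple (measurableTypeR R)) : R :=
  \sum_(j < q) (tnth t j : R) * al j.

Lemma measurable_linform q (al : 'I_q -> R) : measurable_fun setT (linform al).
Proof.
apply: measurable_sum => j; apply: measurable_funM => //.
exact: measurable_tnth.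
Qed.

Lemma linform_tcons q (al : 'I_q.+1 ->
  R) (z : measurableTypeR R * q.-tuple (measurableTypeR R)) :
  linform al (tcons z) = (z.1 * al ord0 + linform (fun j => al (lift ord0 j)) z.2 : R)%R.
Proof.
rewrite /linform big_ord_recl tnth0; congr (_ + _)%R.
by apply: eq_bigr => j _; rewrite tnthS.
Qed.

(** The bound is independent of the dimension, because the variances of the
independent coordinates add up. *)
Lemma gauss_linform_second_moment_le (s : R) q (al : 'I_q -> R) : (0 < s)%R ->
  \int[gauss s q]_t (linform al t ^+ 2)%:E <= (6 * s ^+ 2 * \sum_(j < q) al j ^+ 2)%:E.
Proof.
move=> s0; elim: q al => [|q IH] al.
  rewrite (eq_integral (cst 0)) ?integral0 ?big_ord0 ?mulr0// => t _.
  by rewrite /linform big_ord0 expr0n.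
pose al' j := al (lift ord0 j).
have mlf n (a : 'I_n -> R) : measurable_fun setT (fun t => (linform a t ^+ 2)%:E).
  by apply/measurable_EFinP/measurable_funX; exact: measurable_linform.
have lf0 n (a : 'I_n -> R) t : 0 <= (linform a t ^+ 2)%:E by rewrite lee_fin sqr_ge0.
rewrite /= ge0_integral_distribution//; last exact: mlf.
pose F (z : measurableTypeR R * q.-tuple (measurableTypeR R)) :=
  (linform al (tcons z) ^+ 2)%:E.
have mF : measurable_fun setT F
  by exact: measurableT_comp (mlf _ al) (@measurable_tcons R q).
have F0 z : 0 <= F z by exact: lf0.
rewrite (@fubini_tonelli2 _ _ _ _ R (normal_prob 0 s) (gauss s q) F mF F0).
apply: (@le_trans _ _ (\int[gauss s q]_t ((6 * s ^+ 2 * al ord0 ^+ 2)%:E + (linform al'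
  t ^+ 2)%:E))).
  apply: ge0_le_integral => //.
  - by move=> t _; apply: integral_ge0.
  - exact: (@measurable_fun_fubini_tonelli_G _ _ _ _ R (normal_prob 0 s) F mF F0).
  - exact: (emeasurable_funD (measurable_cst _) (mlf _ al')).
  move=> t _; rewrite /fubini_G -EFinD.
  rewrite (eq_integral (fun x : measurableTypeR R => ((x * al ord0 + linform al' t : R)
    ^+ 2)%:E)).
    exact: normal_affine_second_moment_le.
  by move=> x _; rewrite /F linform_tcons.
rewrite ge0_integralD//; last 2 first.
- by move=> t _; rewrite lee_fin mulr_ge0 ?sqr_ge0// mulr_ge0 ?sqr_ge0.
- exact: mlf.
rewrite integral_cst// [X in _ * X + _](_ : _ = 1);
  last exact: (@probability_setT _ _ _ (gauss s q)).
rewrite mule1 big_ord_recl mulrDr EFinD.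
by apply: leeD => //; exact: IH.
Qed.

End gaussian_vectors.

(** * The discretized operator *)

Section discretized_operator.
Context {R : realType} {Y : completeNormedModType R} (P : problem Y).
Hypothesis hY : Y_hilbert P.
Hypothesis hB : Y_orthogonal_basis P.
Hypothesis hX : X_orthonormal_wavelet_basis P.
Hypothesis hadj : A_adjoint P.
Implicit Types (y z m : Y) (p q : nat).

Let ipYC y z : ipY P y z = ipY P z y.
Proof. by case: hY. Qed.

Let ipYlin c x y z : ipY P (c *: x + y) z = c * ipY P x z + ipY P y z.
Proof. by case: hY. Qed.

Let ipYn y : ipY P y y = `|y| ^+ 2.
Proof. by case: hY. Qed.

Let ipYge0 y : 0 <= ipY P y y.
Proof. by rewrite ipYn sqr_ge0. Qed.

Let bn0 j : `|basY P j| != 0.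
Proof. by rewrite normr_eq0; case: hB. Qed.

Let borth i j : i != j -> ipY P (basY P i) (basY P j) = 0.
Proof. by case: hB => _ h _; exact: h. Qed.

Lemma ipY_projYl q y z :
  ipY P (projY P q y) z
  = \sum_(j < q) (ipY P y (basY P j) / `|basY P j|) * (ipY P z (basY P j) / `|basY P j|).
Proof.
rewrite /projY (form_suml ipYlin); apply: eq_bigr => j _.
by rewrite (ipYC (basY P j)); have := bn0 j => b0; field.
Qed.

Lemma projY_selfadjoint q y z : ipY P (projY P q y) z = ipY P y (projY P q z).
Proof.
by rewrite (ipYC y) !ipY_projYl; apply: eq_bigr => j _; rewrite mulrC.
Qed.

Lemma projY_idem q y : projY P q (projY P q y) = projY P q y.
Proof.
apply: eq_bigr => j _; congr (_ / _ *: _).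
rewrite ipY_projYl (bigD1 j)//= big1 ?addr0 => [|i ij].
  by rewrite ipYn; have := bn0 j => b0; field.
by rewrite (ipYC (basY P j)) borth ?mul0r ?mulr0//.
Qed.

Lemma projY_linear q c x y :
  projY P q (c *: x + y) = c *: projY P q x + projY P q y.
Proof.
rewrite /projY scaler_sumr -big_split/=; apply: eq_bigr => j _.
by rewrite ipYlin mulrDl scalerDl scalerA mulrA.
Qed.

Lemma projY_sum q n (c : 'I_n -> R) (f : 'I_n -> Y) :
  projY P q (\sum_(i < n) c i *: f i) = \sum_(i < n) c i *: projY P q (f i).
Proof.
elim: n c f => [|n IH] c f.
  rewrite !big_ord0 /projY big1// => j _.
  by rewrite (form0l ipYlin) mul0r scale0r.
by rewrite !big_ord_recl projY_linear IH.
Qed.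

Lemma ipY_le y z : ipY P y z <= `|y| * `|z|.
Proof.
apply: (le_trans (ler_norm _)); rewrite -ler_sqr ?nnegrE ?mulr_ge0//.
rewrite real_normK ?num_real// exprMn -!ipYn.
exact: (cauchy_schwarz ipYlin ipYC ipYge0).
Qed.

Lemma normr_projY_le q y : `|projY P q y| <= `|y|.
Proof.
have [->|p0] := eqVneq (projY P q y) 0; first by rewrite normr0.
have p1 : 0 < `|projY P q y| by rewrite normr_gt0.
rewrite -(ler_pM2r p1) -expr2 -ipYn projY_selfadjoint projY_idem.
exact: ipY_le.
Qed.

Definition wimage q I : Y := projY P q (A P (wav P I)).

Lemma WE_sum n (c : 'I_n -> R) (I : nat) :
  W P (\sum_(J < n) c J *: wav P J) I = if insub I is Some i then c i else 0.
Proof.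
have [_ _ ort _] := hX.
rewrite /W ipX_suml; under eq_bigr do rewrite ort.
case: insubP => [i _ iI|In].
  rewrite (bigD1 i)//= iI eqxx mulr1 big1 ?addr0// => J Ji.
  by rewrite -iI (inj_eq val_inj) (negbTE Ji) mulr0.
rewrite big1// => J _; case: eqVneq => [JI|]; last by rewrite mulr0.
by case/negP: In; rewrite -JI.
Qed.

(** The operator sees [u] only through its first wavelet coefficients, and maps
them by the vectors [wimage]. *)
Lemma Apq_sum p q u : Apq p q u = \sum_(J < p) W P u J *: wimage q J.
Proof.
rewrite /Apq /projX /Wadj linear_sum; under eq_bigr do rewrite linearZ.
by rewrite projY_sum.
Qed.

Lemma WApq_adjE p q m (i : 'I_p) : WApq_adj P p q m i 0 = ipY P (wimage q i) m.
Proof.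
rewrite /WApq_adj mxE /Apq_adj /projX /Wadj (WE_sum (fun J : 'I_p => W P _ J)).
by rewrite valK /W ipXC -hadj -projY_selfadjoint.
Qed.

Lemma gramE p q (i j : 'I_p) : gram P p q i j = ipY P (wimage q i) (wimage q j).
Proof.
rewrite mxE WApq_adjE Apq_sum; congr (ipY P _ _).
have [_ _ ort _] := hX.
rewrite (bigD1 j)//= /W ort eqxx scale1r big1 ?addr0// => J Jj.
by rewrite ort eq_sym (inj_eq val_inj) (negbTE Jj) scale0r.
Qed.

(** The Gram matrix is that of the vectors [wimage] for the inner product of the
data space; symmetry and positivity follow. *)
Lemma dotv_gram p q (x y : 'cV[R]_p) : dotv x (gram P p q *m y) =
  ipY P (\sum_(i < p) x i 0 *: wimage q i) (\sum_(i < p) y i 0 *: wimage q i).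
Proof.
rewrite (form_suml ipYlin); apply: eq_bigr => i _; congr (_ * _).
rewrite mxE (form_sumr ipYlin ipYC); apply: eq_bigr => j _.
by rewrite gramE mulrC.
Qed.

Lemma gram_contraction p q (L : R) : 0 < L -> opnorm_le (gram P p q) L ->
  forall w, normv (w - L^-1 *: (gram P p q *m w)) <= normv w.
Proof.
move=> L0 GL; apply: psd_contraction => //.
- by move=> x y; rewrite !dotv_gram ipYC.
- by move=> x; rewrite dotv_gram.
- by move=> x; have := GL x; rewrite !l2norm_zext -EFinM lee_fin.
Qed.

Lemma wimage_le_opnorm p q (L : R) (i : 'I_p) :
  opnorm_le (gram P p q) L -> `|wimage q i| ^+ 2 <= L.
Proof.
move=> /(_ (delta_mx i 0)); rewrite !l2norm_zext -EFinM lee_fin.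
have -> : normv (delta_mx i 0 : 'cV[R]_p) = 1.
  rewrite /normv /dotv (bigD1 i)//= mxE !eqxx mulr1 big1 ?addr0 ?sqrtr1// => j ji.
  by rewrite mxE (negbTE ji) mul0r.
rewrite mulr1; apply: le_trans; rewrite -ipYn -gramE.
apply: le_trans (coord_le_normv _ i);
  rewrite [(_ *m _) _ _]mxE (bigD1 i)//= [delta_mx _ _ _ _]mxE !eqxx mulr1.
rewrite big1 ?addr0 ?ler_norm// => j ji.
by rewrite [delta_mx _ _ _ _]mxE (negbTE ji) mulr0.
Qed.

Lemma WApq_adjB p q y z :
  WApq_adj P p q (y + z) - WApq_adj P p q y = WApq_adj P p q z.
Proof.
have colD (u v w : 'cV[R]_p) : (forall i, u i 0 = v i 0 + w i 0) -> u - v = w.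
  by move=> uvw; apply/colP => i; rewrite !mxE uvw addrC addKr.
apply: colD => i; apply: (eq_trans (WApq_adjE q (y + z) i)).
rewrite (formDr ipYlin ipYC).
by apply: (f_equal2 +%R (esym (WApq_adjE q y i)) (esym (WApq_adjE q z i))).
Qed.

Lemma Yspan_projY q y : Yspan P q (projY P q y).
Proof. by exists (fun j => ipY P y (basY P j) / `|basY P j| ^+ 2). Qed.

Lemma Yspan0 q : Yspan P q 0.
Proof. by exists (fun=> 0); rewrite big1// => j _; rewrite scale0r. Qed.

Lemma YspanN q y : Yspan P q y -> Yspan P q (- y).
Proof.
by move=> [c ->]; exists (fun j => - c j); rewrite -sumrN; apply: eq_bigr => j _;
  rewrite scaleNr.
Qed.

Definition noise_coef q I (j : 'I_q) : R := ipY P (wimage q I) (basY P j) / `|basY P j|.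

Lemma sqr_normv_WApq_adj_embY p q (t : q.-tuple (measurableTypeR R)) :
  normv (WApq_adj P p q (embY P t)) ^+ 2
  = \sum_(i < p) linform (noise_coef i : 'I_q -> R) t ^+ 2.
Proof.
rewrite sqr_normv; apply: eq_bigr => i _; rewrite -expr2 WApq_adjE; congr (_ ^+ 2).
rewrite (form_sumr ipYlin ipYC); apply: eq_bigr => j _.
by rewrite /noise_coef mulrAC mulrA.
Qed.

(** The [noise_coef] are the coordinates of [wimage] in the normalized basis. *)
Lemma sum_noise_coef q I : \sum_(j < q) noise_coef I (j : 'I_q) ^+ 2 = `|wimage q I| ^+ 2.
Proof.
rewrite -ipYn [in RHS]/wimage -{1}projY_idem ipY_projYl.
by apply: eq_bigr => j _; rewrite expr2.
Qed.

Lemma W_wav I J : W P (wav P I) J = (I == J)%:R.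
Proof. by have [_ _ ort _] := hX; rewrite /W ort. Qed.

Lemma W_Xspan p u I : Xspan p u -> (p <= I)%N -> W P u I = 0.
Proof.
move=> [c uc] pI; rewrite /W (eqX_ipX _ uc).
by have := WE_sum c I; rewrite /W => ->; rewrite insubN// -leqNgt.
Qed.

Lemma normX_wav I : normX (wav P I) = 1.
Proof. by have [_ _ ort _] := hX; rewrite /normX ort eqxx sqrtr1. Qed.

Lemma ball1_scale_wav CB p I t : (I < p)%N -> 0 <= t <= CB ->
  ball1 P CB p (t *: wav P I).
Proof.
move=> Ip /andP[t0 tC].
have Wt k : W P (t *: wav P I) k = t * (I == k)%:R by rewrite /W ipXZl -/(W P _ _) W_wav.
have l1 : l1norm (W P (t *: wav P I)) = t%:E.
  rewrite (@l1norm_finite_support _ p); last first.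
    by move=> k pk; rewrite Wt; case: eqVneq => [Ik|];
      [rewrite -Ik leqNgt Ip in pk|rewrite mulr0].
  congr EFin; rewrite (bigD1 (Ordinal Ip))//= Wt eqxx mulr1 big1 ?addr0 ?ger0_norm// =>
    j jI.
  rewrite Wt; case: eqVneq => [Ij|_]; last by rewrite mulr0 normr0.
  by case/negP: jI; apply/eqP/val_inj.
split; rewrite ?l1 ?ltry ?lee_fin//.
exists (fun J : 'I_p => t * (I == J :> nat)%:R).
suff -> : \sum_(J < p) (t * (I == J :> nat)%:R) *: wav P J = t *: wav P I by apply: aeW.
rewrite (bigD1 (Ordinal Ip))//= eqxx mulr1 big1 ?addr0// => j jI.
case: eqVneq => [Ij|_]; last by rewrite mulr0 scale0r.
by case/negP: jI; apply/eqP/val_inj.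
Qed.

End discretized_operator.

(** * Integrals of functions not known to be measurable *)

Section lower_integrals.
Local Open Scope ereal_scope.
Import HBNNSimple.

(** The integral of a nonnegative function is a supremum over the simple functions
below it, hence monotone for all nonnegative functions.  This spares proving
that the error of a network is measurable. *)
Lemma le_lower_integral d (T : measurableType d) (R : realType)
    (mu : {measure set T -> \bar R}) (f g : T -> \bar R) :
  (forall x, 0 <= f x) -> (forall x, f x <= g x) ->
  \int[mu]_x f x <= \int[mu]_x g x.
Proof.
move=> f0 fg; have g0 x : 0 <= g x by exact: le_trans (fg x).
rewrite !ge0_integralTE//; apply: le_ereal_sup => _ [h hf <-].
by exists h => // x; exact: le_trans (hf x) (fg x).
Qed.

(** From f <= c / 2 + f^2 / (2 c), applied to the simple functions below f. *)
Lemma integral_le_second_moment d (T : measurableType d) (R : realType)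
    (mu : probability T R) (f : T -> \bar R) (c : R) : (0 < c)%R ->
  (forall x, 0 <= f x) ->
  \int[mu]_x f x <= (c / 2)%:E + (c^-1 / 2)%:E * \int[mu]_x (f x ^+ 2).
Proof.
move=> c0 f0; have c20 : (0 <= c^-1 / 2)%R by rewrite divr_ge0// invr_ge0 ltW.
have mX (h : {nnsfun T >-> R}) : measurable_fun setT (fun x => (h x ^+ 2)%:E).
  by apply/measurable_EFinP/measurable_funX.
rewrite {1}ge0_integralTE//; apply: ge_ereal_sup => _ [h hf <-].
rewrite -integralT_nnsfun.
apply: (@le_trans _ _ (\int[mu]_x ((c / 2)%:E + (c^-1 / 2)%:E * (h x ^+ 2)%:E))).
  apply: ge0_le_integral => //.
  - by move=> x _; rewrite lee_fin.
  - exact/measurable_EFinP.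
  - by apply: emeasurable_funD => //; exact: emeasurable_funM.
  move=> x _; rewrite /= -EFinM -EFinD lee_fin.
  have : (0 <= (c - h x) ^+ 2 * (c^-1 / 2))%R by rewrite mulr_ge0// sqr_ge0.
  have -> : ((c - h x) ^+ 2 * (c^-1 / 2) = c / 2 + c^-1 / 2 * h x ^+ 2 - h x)%R.
    by field; rewrite gt_eqF.
  by rewrite subr_ge0.
rewrite ge0_integralD//; last 3 first.
- by move=> x _; rewrite lee_fin divr_ge0// ltW.
- by move=> x _; rewrite mule_ge0// lee_fin sqr_ge0.
- exact: emeasurable_funM.
rewrite integral_cst// [X in _ * X + _](_ : _ = 1); last exact: probability_setT.
rewrite mule1; apply: leeD => //.
rewrite ge0_integralZl_EFin//; last by move=> x _; rewrite lee_fin sqr_ge0.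
apply: lee_wpmul2l; first by rewrite lee_fin.
apply: le_lower_integral => x; first by rewrite lee_fin sqr_ge0.
by rewrite EFin_expe !expe2; apply: lee_pmul; rewrite ?lee_fin//.
Qed.

End lower_integrals.

(** * Error and loss of the reference network *)

Section network_error.
Context {R : realType} {Y : completeNormedModType R} (P : problem Y).
Hypothesis hY : Y_hilbert P.
Hypothesis hB : Y_orthogonal_basis P.
Hypothesis hX : X_orthonormal_wavelet_basis P.
Hypothesis hadj : A_adjoint P.
Variable C : config P.
Notation p := (dimp C).
Notation q := (dimq C).

Lemma err_normv CB th u eps : ball1 P CB p u ->
  err C th u eps = (normv (net C th (Apq p q u + eps) - trunc p (W P u)))%:E.
Proof.
move=> [uX _ _]; rewrite /err -l2norm_zext; congr l2norm; apply/funext => I.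
by rewrite zextB zext_trunc// => k pk; exact: (W_Xspan hX uX pk).
Qed.

(** The noise - A_pq u turns the data of u = 3 c5 d psi_I into those of 0.  If its
norm is at most d, then one output lies within c5 d of both u and 0, although
these are 3 c5 d apart. *)
Lemma wimage_lower_bound CB c5 d I : 0 < c5 -> 0 < d -> 3 * c5 * d <= CB ->
  small_noise_bound CB c5 d C -> (I < p)%N -> (3 * c5)^-1 < `|wimage P q I|.
Proof.
move=> c50 d0 dCB small Ip; rewrite ltNge; apply/negP => aI.
have c30 : 0 < 3 * c5 by rewrite mulr_gt0.
pose t := 3 * c5 * d.
have t0 : 0 < t by rewrite mulr_gt0.
have b1 : ball1 P CB p (t *: wav P I) by apply: ball1_scale_wav => //; rewrite ltW.
have b0 : ball1 P CB p (0 *: wav P I).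
  by apply: ball1_scale_wav => //; rewrite lexx /= (le_trans _ dCB)// ltW.
have Wt s k : W P (s *: wav P I) k = s * (I == k)%:R.
  by rewrite /W ipXZl -/(W P _ _) (W_wav hX).
have At s : Apq p q (s *: wav P I) = s *: wimage P q I.
  rewrite (Apq_sum hY) (bigD1 (Ordinal Ip))//= Wt eqxx mulr1 big1 ?addr0// => j jI.
  rewrite Wt; case: eqVneq => [Ij|_]; last by rewrite mulr0 scale0r.
  by case/negP: jI; apply/eqP/val_inj.
have bound s (eps : Y) : ball1 P CB p (s *: wav P I) -> Yspan P q eps -> `|eps| <= d ->
    eps = - (s *: wimage P q I) -> `|net C (theta0 C) 0 (Ordinal Ip) 0 - s| <= c5 * d.
  move=> bs Ys ed eE; have := small _ _ bs Ys ed.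
  rewrite (err_normv _ _ bs) At eE subrr lee_fin; apply: le_trans.
  apply: le_trans (coordB_le_normv _ _ (Ordinal Ip)).
  by rewrite truncE Wt /= eqxx mulr1.
have h1 : `|net C (theta0 C) 0 (Ordinal Ip) 0 - t| <= c5 * d.
  have Yt : Yspan P q (- (t *: wimage P q I)).
    by apply: YspanN; rewrite -At; exact: Yspan_projY.
  apply: (bound t _ b1 Yt _ erefl).
  rewrite normrN normrZ gtr0_norm//.
  have : t * `|wimage P q I| <= t * (3 * c5)^-1 by rewrite ler_wpM2l// ltW.
  by have -> : t * (3 * c5)^-1 = d by [rewrite /t; field; rewrite gt_eqF].
have h0 : `|net C (theta0 C) 0 (Ordinal Ip) 0 - 0| <= c5 * d.
  apply: (bound 0 0 b0 (Yspan0 P q)); first by rewrite normr0 ltW.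
  by rewrite scale0r oppr0.
move: h1 h0; rewrite !ler_norml /t => /andP[h1 h2] /andP[h3 h4].
have : 0 < c5 * d by rewrite mulr_gt0.
lra.
Qed.

(** The factor of one layer is 1 + d / (N L): a contraction for the Gram matrix,
perturbed by Z at distance at most d / N. *)
Lemma net_lipschitz c0 a d y z : 0 < c0 -> 0 < d -> (0 < depth C)%N ->
  0 < lip (theta0 C) -> reference c0 a d C ->
  normv (net C (theta0 C) (y + z) - net C (theta0 C) y)
    <= (depth C)%:R * expR (d / lip (theta0 C)) * ((lip (theta0 C))^-1 * normv
      (WApq_adj P p q z)).
Proof.
move=> c00 d0 N0 L0 [[_ lamE GL _ _] [Z [ZG KZ]]].
set L := lip _ in L0 GL *; set N := depth C in N0 ZG KZ *.
have NR0 : 0 < N%:R :> R by rewrite ltr0n.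
pose r := 1 + d / N%:R / L.
have r1 : 1 <= r by rewrite lerDl !divr_ge0// ltW.
have step n : (1 <= n <= N)%N -> forall w,
    normv (w - L^-1 *: (Kmat P (winsize C) p (theta0 C) n *m w)) <= r * normv w.
  move=> nN w; rewrite KZ//.
  have -> : w - L^-1 *: (Z *m w) =
    (w - L^-1 *: (gram P p q *m w)) + L^-1 *: ((gram P p q - Z) *m w).
    by rewrite mulmxBl scalerBr addrA subrK.
  apply: (le_trans (normvD _ _)); rewrite /r mulrDl mul1r; apply: lerD.
    exact: (gram_contraction hY hB hX hadj L0 GL).
  rewrite normvZ gtr0_norm ?invr_gt0// mulrC [leRHS]mulrAC ler_wpM2r ?invr_ge0 ?(ltW
    L0)//.
  by have := ZG w; rewrite !l2norm_zext -EFinM lee_fin.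
apply: (le_trans (@unroll_lipschitz _ _ _ _ _ r _ _ _ _ L0 _ r1 step)).
  by rewrite lamE mulr_ge0// ltW.
rewrite (WApq_adjB hY hB hX hadj) ler_wpM2r ?mulr_ge0 ?normv_ge0 ?invr_ge0 ?(ltW L0)//.
rewrite ler_wpM2l//.
apply: (@le_trans _ _ (expR (d / N%:R / L) ^+ N)).
  by apply: lerXn2r; rewrite ?nnegrE ?expR_ge0 ?expR_ge1Dx//; lra.
rewrite -expRM_natl; rewrite ler_expR.
by rewrite le_eqVlt; apply/orP; left; apply/eqP; field; rewrite !gt_eqF.
Qed.

End network_error.

Section reference_loss.
Context {R : realType} {Y : completeNormedModType R} (P : problem Y).
Hypothesis hY : Y_hilbert P.
Hypothesis hB : Y_orthogonal_basis P.
Hypothesis hX : X_orthonormal_wavelet_basis P.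
Hypothesis hadj : A_adjoint P.
Variable C : config P.
Notation p := (dimp C).
Notation q := (dimq C).
Local Open Scope ereal_scope.

(** The Lipschitz constant of the reference network as a function of A_pq^* m. *)
Definition noise_gain (d : R) : R :=
  ((depth C)%:R * expR (d / lip (theta0 C)) / lip (theta0 C))%R.

(** The noise enters the network through [p] linear forms, each of which has
variance at most (s CA)^2 up to a constant, however large [q] is. *)
Lemma integral_noise_le s CA : (0 < s)%R -> (forall I, (`|wimage P q I| <= CA)%R) ->
  \int[gauss s q]_t (normv (WApq_adj P p q (embY P t)) ^+ 2)%:E
    <= (6 * s ^+ 2 * (p%:R * CA ^+ 2))%:E.
Proof.
move=> s0 wCA.
have mlf i : measurable_fun setT (fun t => (linform (noise_coef P i : 'I_q ->
  R) t ^+ 2)%:E).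
  by apply/measurable_EFinP/measurable_funX; exact: measurable_linform.
rewrite (eq_integral (fun t => \sum_(i < p) (linform (noise_coef P i : 'I_q ->
  R) t ^+ 2)%:E)); last first.
  by move=> t _; rewrite (sqr_normv_WApq_adj_embY hY hB hX hadj) sumEFin.
rewrite ge0_integral_sum//; last by move=> i t _; rewrite lee_fin sqr_ge0.
apply: (@le_trans _ _ (\sum_(i < p) (6 * s ^+ 2 * CA ^+ 2)%:E)).
  apply: lee_sum => i _; apply: (le_trans (gauss_linform_second_moment_le _ s0)).
  rewrite lee_fin (sum_noise_coef hY hB); apply: ler_wpM2l.
    by rewrite mulr_ge0 ?sqr_ge0.
  by apply: lerXn2r; rewrite ?nnegrE// (le_trans _ (wCA i)).
by rewrite sumEFin lee_fin sumr_const card_ord -[X in (X <= _)%R]mulr_natl mulrCA.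
Qed.

(** The squared error is at most 2 (c5 d)^2 + 2 kappa^2 |A_pq^* eps|^2 off the null
set where [u] leaves the ball; there the majorant is made infinite, so that it
dominates everywhere. *)
Lemma loss_theta0_le (CB c0 a c5 d s CA : R) :
  (0 < c0)%R -> (0 < d)%R -> (0 < s)%R -> (0 < depth C)%N -> (0 < lip (theta0 C))%R ->
  reference c0 a d C -> law_on_ball CB C -> small_noise_bound CB c5 d C ->
  (forall I, (`|wimage P q I| <= CA)%R) ->
  loss C s (theta0 C) <=
    (2 * (c5 * d) ^+ 2 + 2 * noise_gain d ^+ 2 * (6 * s ^+ 2 * (p%:R * CA ^+ 2)))%:E.
Proof.
move=> c00 d0 s0 N0 L0 href [N [mN N00 subN]] small wCA.
set kap := noise_gain d.
pose n (t : q.-tuple (measurableTypeR R)) : R := normv (WApq_adj P p q (embY P t)).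
have mn : measurable_fun setT (fun t => (n t ^+ 2)%:E).
  apply: (eq_measurable_fun (fun t => (\sum_(i < p) linform (noise_coef P i : 'I_q ->
    R) t ^+ 2)%:E)).
    by move=> t _; rewrite /n (sqr_normv_WApq_adj_embY hY hB hX hadj).
  apply/measurable_EFinP; apply: measurable_sum => i.
  by apply: measurable_funX; exact: measurable_linform.
pose h t := (2 * (c5 * d) ^+ 2)%:E + (2 * kap ^+ 2)%:E * (n t ^+ 2)%:E.
have k0 : (0 <= 2 * kap ^+ 2)%R by rewrite mulr_ge0// sqr_ge0.
have c0' : (0 <= 2 * (c5 * d) ^+ 2)%R by rewrite mulr_ge0// sqr_ge0.
have mkn : measurable_fun setT (fun t => (2 * kap ^+ 2)%:E * (n t ^+ 2)%:E).
  exact: emeasurable_funM.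
have kn0 t : 0 <= (2 * kap ^+ 2)%:E * (n t ^+ 2)%:E.
  by rewrite mule_ge0// lee_fin// sqr_ge0.
have mh : measurable_fun setT h by exact: emeasurable_funD.
have h0 t : 0 <= h t by rewrite adde_ge0// lee_fin.
have Hh : \int[gauss s q]_t h t <=
    (2 * (c5 * d) ^+ 2 + 2 * kap ^+ 2 * (6 * s ^+ 2 * (p%:R * CA ^+ 2)))%:E.
  rewrite /h ge0_integralD//.
  rewrite integral_cst// [X in _ * X + _](_ : _ = 1);
    last exact: (@probability_setT _ _ _ (gauss s q)).
  rewrite mule1 ge0_integralZl_EFin//; last by move=> t _; rewrite lee_fin sqr_ge0.
  rewrite EFinD; apply: leeD => //; rewrite [leRHS]EFinM; apply: lee_wpmul2l;
    first by rewrite lee_fin.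
  exact: integral_noise_le.
(* The infinite part of the majorant, carried by a null set. *)
pose bad (u : g_sigma_algebraType (@coef_events _ _ P)) : \bar R := +oo * (\1_N u)%:E.
have mbad : measurable_fun setT bad.
  by apply: emeasurable_funM => //; apply/measurable_EFinP; exact: measurable_indic.
have bad0 u : 0 <= bad u by rewrite mule_ge0// lee_fin.
have bound z : err C (theta0 C) z.1 (embY P z.2) ^+ 2 <= h z.2 + bad z.1.
  have [Nz|nNz] := pselect (N z.1).
    by rewrite /bad indicE mem_set// mule1 addey ?leey//.
  rewrite /bad indicE memNset// mule0 adde0.
  have bz : ball1 P CB p z.1 by apply: contrapT => nb; exact/nNz/subN.
  have b1 : (normv (net C (theta0 C) (Apq p q z.1) - trunc p (W P z.1)) <= c5 * d)%R.
    have := small _ 0%R bz (Yspan0 P q); rewrite normr0 => /(_ (ltW d0)).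
    by rewrite (err_normv hX _ _ bz) addr0 lee_fin.
  rewrite (err_normv hX _ _ bz) /h -EFin_expe -EFinM -EFinD lee_fin.
  set D := normv _.
  have D0 : (0 <= D)%R by exact: normv_ge0.
  have Dle : (D <= c5 * d + kap * n z.2)%R.
    have lipz := net_lipschitz hY hB hX hadj (Apq p q z.1) (embY P z.2) c00 d0 N0 L0 href.
    have tri (x y w : 'cV[R]_p) : (normv (x - w) <= normv (y - w) + normv (x - y))%R.
      have -> : (x - w = (y - w) + (x - y))%R by rewrite [RHS]addrC addrA subrK.
      exact: normvD.
    apply: (le_trans (tri _ (net C (theta0 C) (Apq p q z.1)) _)); apply: lerD => //.
    by apply: (le_trans lipz); rewrite /kap /noise_gain /n mulrA.
  have : (D ^+ 2 <= (c5 * d + kap * n z.2) ^+ 2)%R.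
    by rewrite lerXn2r// nnegrE (le_trans D0).
  have -> : (2 * kap ^+ 2 * n z.2 ^+ 2 = 2 * (kap * n z.2) ^+ 2)%R by ring.
  have := sqr_ge0 (c5 * d - kap * n z.2)%R.
  by move: (c5 * d)%R (kap * n z.2)%R => x y; rewrite sqrrB sqrrD; lra.
apply: (@le_trans _ _ (\int[law C \x gauss s q]_z (h z.2 + bad z.1))).
  by apply: le_lower_integral => // z; exact: sqre_ge0.
have mh2 : measurable_fun setT (fun z : g_sigma_algebraType (@coef_events _ _ P) *
  q.-tuple (measurableTypeR R) => h z.2).
  exact: (measurableT_comp mh measurable_snd).
have mb1 : measurable_fun setT (fun z : g_sigma_algebraType (@coef_events _ _ P) *
  q.-tuple (measurableTypeR R) => bad z.1).
  exact: (measurableT_comp mbad measurable_fst).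
rewrite ge0_integralD//.
rewrite (@fubini_tonelli2 _ _ _ _ R (law C) (gauss s q) _ mh2 (fun z => h0 z.2)).
rewrite (@fubini_tonelli1 _ _ _ _ R (law C) (gauss s q) _ mb1 (fun z => bad0 z.1)).
rewrite [X in _ + X](_ : _ = 0).
  rewrite adde0; apply: le_trans Hh; rewrite le_eqVlt; apply/orP; left; apply/eqP.
  apply: eq_integral => t _; rewrite /fubini_G/= integral_cst//.
  by rewrite [X in _ * X](_ : _ = 1) ?mule1//; exact: (@probability_setT _ _ _ (law C)).
rewrite (eq_integral bad); last first.
  move=> u _; rewrite /fubini_F/= integral_cst//.
  by rewrite [X in _ * X](_ : _ = 1) ?mule1//;
    exact: (@probability_setT _ _ _ (gauss s q)).
rewrite (@ae_eq_integral _ _ _ _ _ (cst 0)) ?integral0//.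
exists N; split => // u /= nu; apply: contrapT => nNu; apply: nu => _.
by rewrite /bad indicE memNset// mule0.
Qed.

End reference_loss.

(** * Small noise levels *)

(** From - ln d <= 1 / d. *)
Lemma depth_bounds (R : realType) (a d : R) (N : nat) : 0 < a < 1 -> 0 < d < 1 ->
  N%:Z = Num.ceil (ln d / ln a) ->
  (0 < N)%N /\ N%:R <= ((- ln a)^-1 + 1) / d.
Proof.
move=> a01 d01 NE; have la := ln_lt0 a01; have ld := ln_lt0 d01.
case/andP: d01 => d0 d1.
have x0 : 0 < ln d / ln a by rewrite -mulrNN mulr_gt0 ?oppr_gt0 ?invr_lt0//.
split; first by rewrite -ltz_nat NE ceil_gt0.
have id1 : 1 < d^-1 by rewrite invf_gt1.
have ldV : - ln d <= d^-1.
  rewrite -lnV ?posrE//; apply: (@le_trans _ _ (d^-1 - 1)); last by lra.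
  have := @le_ln1Dx R (d^-1 - 1); rewrite (_ : 1 + (d^-1 - 1) = d^-1); last by ring.
  by apply; lra.
have /andP[+ _] := ceil_itv (ln d / ln a).
rewrite -NE rmorphB/= -pmulrn => h.
have xle : ln d / ln a <= d^-1 * (- ln a)^-1.
  by rewrite -mulrNN -invrN ler_wpM2r// invr_ge0; lra.
have : N%:R <= d^-1 * (- ln a)^-1 + 1 by lra.
rewrite mulrDl mul1r [(- ln a)^-1 * _]mulrC => h2; lra.
Qed.

Lemma noise_term_le (R : realType) (k M d T T' : R) :
  0 < d <= 1 -> 0 <= k <= M / d -> 0 <= T <= T' -> 12 * M ^+ 2 * T' * d <= 1 ->
  2 * k ^+ 2 * (6 * (d ^+ 3) ^+ 2 * T) <= d ^+ 2.
Proof.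
move=> /andP[d0 d1] /andP[k0 kM] /andP[T0 TT'] QdE.
have kT : k ^+ 2 * T <= (M / d) ^+ 2 * T'.
  apply: ler_pM => //; first exact: sqr_ge0.
  by apply: lerXn2r => //; rewrite nnegrE (le_trans k0).
have X0 : 0 <= 12 * (d ^+ 3) ^+ 2 by apply: mulr_ge0 => //; exact: sqr_ge0.
apply: (@le_trans _ _ (12 * (d ^+ 3) ^+ 2 * ((M / d) ^+ 2 * T'))).
  apply: le_trans (ler_wpM2l X0 kT).
  by rewrite le_eqVlt; apply/orP; left; apply/eqP; ring.
have -> : 12 * (d ^+ 3) ^+ 2 * ((M / d) ^+ 2 * T') = (12 * M ^+ 2 * T' * d) * d * d ^+ 2.
  by field; rewrite gt_eqF.
rewrite -[leRHS]mul1r ler_wpM2r ?sqr_ge0//.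
apply: (@le_trans _ _ (1 * d)); last by rewrite mul1r.
by rewrite ler_wpM2r// ltW.
Qed.

Lemma half_lower_bound (R : realType) (A0 w e c d : R) :
  0 < c -> A0 <= e + w -> e <= c * d -> d < A0 / (2 * c) -> A0 / 2 <= w.
Proof.
move=> c0 h1 h2; rewrite ltr_pdivlMr ?mulr_gt0// => h3; lra.
Qed.

Section asymptotics.
Context {R : realType} {Y : completeNormedModType R} (P : problem Y).
Hypothesis hP : standing_assumptions P.

Let hY : Y_hilbert P. Proof. by case: hP => -[]. Qed.
Let hB : Y_orthogonal_basis P. Proof. by case: hP => -[]. Qed.
Let hX : X_orthonormal_wavelet_basis P. Proof. by case: hP => -[]. Qed.
Let hadj : A_adjoint P. Proof. by case: hP => _ []. Qed.
Let hconv : AA_convolutional P. Proof. by case: hP => _ []. Qed.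

Lemma wav_image_neq0 I : A P (wav P I) != 0.
Proof.
have [_ [_ hinj _ _]] := hP; have [_ _ ort _] := hX.
apply/eqP => AI0; have := hinj (wav P I) 0; rewrite linear0 AI0 => /(_ erefl).
move=> /(eqX_ipX (wav P I)); rewrite ort eqxx ipX0l => /eqP.
by rewrite oner_eq0.
Qed.

(** All parameters of the configuration are controlled by constants of the
problem: [p] by the index of a wavelet with small image, [L] from below by the
image of the first wavelet, the depth by a multiple of 1 / d. *)
Lemma near_loss_theta0_le (CB c0 a c_p c_q c5 : R) (C : R -> config P) :
  [/\ 0 < CB, 0 < c0, 0 < c_q & 0 < c5] -> 0 < a < 1 ->
  (\forall d \near 0^'+, discretization CB c_p c_q d (C d)) ->
  (\forall d \near 0^'+, law_on_ball CB (C d)) ->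
  (\forall d \near 0^'+, reference c0 a d (C d)) ->
  (\forall d \near 0^'+, small_noise_bound CB c5 d (C d)) ->
  \forall d \near 0^'+,
    (loss (C d) (d ^+ 3) (theta0 (C d)) <= ((2 * c5 ^+ 2 + 1) * d ^+ 2)%:E)%E.
Proof.
move=> [CB0 c00 cq0 c50] a01 ndisc nlaw nref nsmall.
have [_ [[CA hCA] _ _ _]] := hP.
have c30 : 0 < (3 * c5)^-1 by rewrite invr_gt0 mulr_gt0.
have [I0 hI0] := exists_small_wavelet_image hY hX hadj hconv c30.
pose A0 := `|A P (wav P 0)|.
have A00 : 0 < A0 by rewrite normr_gt0 wav_image_neq0.
have CA0 : 0 < CA.
  by apply: (lt_le_trans A00); apply: (le_trans (hCA _)); rewrite (normX_wav hX) mulr1.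
have wCA q I : `|wimage P q I| <= CA.
  by apply: (le_trans (normr_projY_le hY hB _ _)); apply: (le_trans (hCA _));
    rewrite (normX_wav hX) mulr1.
pose l0 := A0 ^+ 2 / 4.
have l00 : 0 < l0 by rewrite divr_gt0 ?exprn_gt0.
have la0 : 0 < - ln a by rewrite oppr_gt0 ln_lt0.
pose M := ((- ln a)^-1 + 1) * (expR l0^-1 / l0).
have M0 : 0 < M.
  apply: mulr_gt0; last by rewrite divr_gt0 ?expR_gt0.
  by apply: addr_gt0 => //; rewrite invr_gt0.
pose Q := 12 * M ^+ 2 * (I0%:R * CA ^+ 2).
have Q0 : 0 <= Q by apply: mulr_ge0; apply: mulr_ge0 => //; exact: sqr_ge0.
near=> d.
have d0 : 0 < d by near: d; exact: nbhs_right_gt.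
have d1 : d < 1 by near: d; exact: nbhs_right_lt.
have dA : d < A0 / (2 * c_q) by near: d; apply: nbhs_right_lt;
  rewrite divr_gt0// mulr_gt0.
have dCB : d < CB / (3 * c5) by near: d; apply: nbhs_right_lt;
  rewrite divr_gt0// mulr_gt0.
have dQ : d < (Q + 1)^-1 by near: d; apply: nbhs_right_lt; rewrite invr_gt0 ltr_wpDl.
have [J0J _ hdisc] : discretization CB c_p c_q d (C d) by near: d.
have hlaw : law_on_ball CB (C d) by near: d.
have href : reference c0 a d (C d) by near: d.
have hsmall : small_noise_bound CB c5 d (C d) by near: d.
have pI0 : (dimp (C d) <= I0)%N.
  rewrite leqNgt; apply/negP => I0p.
  have dCB' : 3 * c5 * d <= CB.
    by move: dCB; rewrite ltr_pdivlMr ?mulr_gt0// => /ltW; rewrite mulrC.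
  have := wimage_lower_bound hY hX c50 d0 dCB' hsmall I0p.
  rewrite ltNge => /negP; apply; apply: le_trans (ltW hI0).
  exact: normr_projY_le.
have [[_ _ GL _ NE] _] := href.
have [N0 Nle] := depth_bounds a01 (introT andP (conj d0 d1)) NE.
have p0 : (0 < dimp (C d))%N by rewrite expn_gt0.
have L0 : l0 <= lip (theta0 (C d)).
  apply: le_trans (wimage_le_opnorm hY hB hX hadj (Ordinal p0) GL).
  have : A0 / 2 <= `|wimage P (dimq (C d)) 0|.
    have := hdisc (wav P 0); rewrite (normX_wav hX) mulr1 => h.
    have hA : A0 <= `|A P (wav P 0) - wimage P (dimq (C d)) 0| + `|wimage P (dimq (C
      d)) 0|.
      by apply: le_trans (ler_normD _ _); rewrite subrK.
    exact: (half_lower_bound cq0 hA h dA).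
  move=> h; rewrite /l0 (_ : A0 ^+ 2 / 4 = (A0 / 2) ^+ 2); last by field.
  by apply: lerXn2r; rewrite ?nnegrE//; rewrite divr_ge0// ltW.
have L00 : 0 < lip (theta0 (C d)) by apply: lt_le_trans L0.
have d30 : 0 < d ^+ 3 by rewrite exprn_gt0.
apply: (le_trans (loss_theta0_le hY hB hX hadj c00 d0 d30 N0 L00 href hlaw hsmall (wCA
  _))).
rewrite lee_fin.
set kap := noise_gain _ _.
have kap0 : 0 <= kap by rewrite /kap /noise_gain !mulr_ge0 ?expR_ge0// invr_ge0 ltW.
have kapM : kap <= M / d.
  rewrite /kap /noise_gain /M -mulrA [leRHS]mulrAC; apply: ler_pM => //.
    by rewrite divr_ge0 ?expR_ge0// ltW.
  apply: ler_pM; rewrite ?expR_ge0 ?invr_ge0 ?(ltW L00)//.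
    rewrite ler_expR -[leRHS]mul1r; apply: ler_pM => //;
      rewrite ?invr_ge0 ?(ltW L00) ?(ltW d0) ?(ltW d1)//.
    by rewrite lef_pV2 ?posrE.
  by rewrite lef_pV2 ?posrE.
have Qd : 12 * M ^+ 2 * (I0%:R * CA ^+ 2) * d <= 1.
  rewrite -/Q; have Q1 : 0 < Q + 1 by rewrite ltr_wpDl.
  move: dQ; rewrite -[X in _ < X]div1r ltr_pdivlMr// mulrDr mulr1 mulrC => /ltW.
  by apply: le_trans; rewrite lerDl ltW.
have := @noise_term_le R kap M d ((dimp (C d))%:R * CA ^+ 2) (I0%:R * CA ^+ 2).
rewrite d0 (ltW d1) kap0 kapM Qd => /(_ isT isT).
have T0 : 0 <= (dimp (C d))%:R * CA ^+ 2 by apply: mulr_ge0 => //; exact: sqr_ge0.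
rewrite T0 ler_wpM2r ?sqr_ge0 ?ler_nat// => /(_ isT isT) h.
rewrite [leRHS]mulrDl mul1r; apply: lerD => //.
by rewrite exprMn mulrA.
Unshelve. all: by end_near. Qed.

End asymptotics.

Lemma cube_root_cubed (R : realType) (s : R) : 0 < s -> (s `^ 3^-1) ^+ 3 = s.
Proof.
move=> s0; rewrite -powR_mulrn ?powR_ge0// -powRrM mulVf// powRr1//.
exact: ltW.
Qed.

Lemma near0_rightP (R : realType) (Q : R -> Prop) :
  (\forall d \near 0^'+, Q d) <-> exists2 e : R, 0 < e & forall d, 0 < d -> d < e -> Q d.
Proof.
split=> [[e /= e0 eQ]|[e e0 eQ]].
  exists e => // d d0 de; apply: eQ => //.
  by rewrite /ball/= sub0r normrN gtr0_norm.
near=> d; apply: eQ; near: d; [exact: nbhs_right_gt|exact: nbhs_right_lt].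
Unshelve. all: by end_near. Qed.

Lemma near_cube_root (R : realType) (Q : R -> Prop) :
  (\forall d \near 0^'+, Q d) -> \forall s \near 0^'+, Q (s `^ 3^-1).
Proof.
move=> /near0_rightP[e e0 eQ]; apply/near0_rightP; exists (e ^+ 3).
  by rewrite exprn_gt0.
move=> s s0 se; apply: eQ; first exact: powR_gt0.
rewrite -(@ltr_pXn2r _ 3)// ?nnegrE ?powR_ge0 ?ltW//.
by rewrite cube_root_cubed.
Qed.

Unset Implicit Arguments.

Theorem proposition4p3 (R : realType) :
  exists cstar : R -> R -> R -> R,
    (forall x y z, 0 < x -> 0 < y -> 0 < z -> 0 < cstar x y z) /\
    forall (Y : completeNormedModType R) (P : problem Y)
      (CB c0 a c_p c_q c5 : R) (k1 k2 : R -> R)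
      (C : R -> config P)
      (thetastar : R -> params R),
    let delta (sigma : R) := sigma `^ 3^-1 in
    standing_assumptions P ->
    [/\ 0 < CB, 0 < c0, 0 < c_p, 0 < c_q & 0 < c5] ->
    0 < a < 1 ->
    (\forall d \near 0^'+, discretization CB c_p c_q d (C d)) ->
    (\forall d \near 0^'+, law_on_ball CB (C d)) ->
    (\forall d \near 0^'+, reference c0 a d (C d)) ->
    (\forall d \near 0^'+, small_noise_bound CB c5 d (C d)) ->
    (\forall d \near 0^'+,
       [/\ 0 < k1 d, 0 < k2 d & growth_bound CB (k1 d) (k2 d) (C d)]) ->
    (\forall sigma \near 0^'+,
       is_argmin (C (delta sigma)) sigma (thetastar sigma)) ->
    (exists sigma1 : R, 0 < sigma1 /\
       forall sigma : R, 0 < sigma ->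
         sigma <= Num.min sigma1 ((dimq (C (delta sigma)))%:R `^ (- 2^-1)) ->
         (loss (C (delta sigma)) sigma (thetastar sigma)
          <= (cstar c5 (k1 (delta sigma)) (k2 (delta sigma))
              * delta sigma ^+ 2)%:E)%E)
    /\
    mean_err (C (delta sigma)) sigma (thetastar sigma)
      @[sigma --> within
          [set sigma | sigma <= (dimq (C (delta sigma)))%:R `^ (- 2^-1)]
          (0 : R)^'+] --> 0%E.
Proof.
(* 2 x^2 comes from the noiseless error and (u + v)^2 <= 2 u^2 + 2 v^2; the
   noise contributes at most d^2 once d is small. *)
exists (fun x _ _ => 2 * x ^+ 2 + 1); split.
  by move=> x y z _ _ _; rewrite ltr_wpDl// mulr_ge0// sqr_ge0.
move=> Y P CB c0 a c_p c_q c5 k1 k2 C thetastar delta hP [CB0 c00 _ cq0 c50] a01.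
move=> ndisc nlaw nref nsmall _ nargmin.
have nloss0 := near_loss_theta0_le hP (And4 CB0 c00 cq0 c50) a01 ndisc nlaw nref nsmall.
pose K := 2 * c5 ^+ 2 + 1.
have nloss : \forall s \near 0^'+,
    (loss (C (delta s)) s (thetastar s) <= (K * delta s ^+ 2)%:E)%E.
  near=> s.
  have s0 : 0 < s by near: s; exact: nbhs_right_gt.
  have [_ opt] : is_argmin (C (delta s)) s (thetastar s) by near: s.
  have [[Th0 _ _ _ _] _] : reference c0 a (delta s) (C (delta s)).
    by near: s; exact: (near_cube_root nref).
  apply: (le_trans (opt _ Th0)).
  have : (loss (C (delta s)) (delta s ^+ 3) (theta0 (C (delta s))) <=
    (K * delta s ^+ 2)%:E)%E.
    by near: s; exact: (near_cube_root nloss0).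
  by rewrite /delta cube_root_cubed.
split.
  have /near0_rightP[e e0 eL] := nloss.
  exists (e / 2); split; first by rewrite divr_gt0.
  move=> s s0; rewrite le_min => /andP[se _]; apply: eL => //; lra.
have K0 : 0 < K by rewrite ltr_wpDl// mulr_ge0// sqr_ge0.
apply/ge0_cvge0P => [s|e e0].
  by apply: integral_ge0 => z _; exact: Lnorm_ge0.
have e10 : 0 < e / (1 + K) by rewrite divr_gt0// addr_gt0.
have : \forall s \near (0 : R)^'+,
    (mean_err (C (delta s)) s (thetastar s) <= e%:E)%E.
  near=> s.
  have s0 : 0 < s by near: s; exact: nbhs_right_gt.
  have d0 : 0 < delta s by exact: powR_gt0.
  have de : delta s < e / (1 + K).
    by near: s; apply: (@near_cube_root _ (fun d => d < e / (1 + K)));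
      exact: nbhs_right_lt.
  have ls : (loss (C (delta s)) s (thetastar s) <= (K * delta s ^+ 2)%:E)%E by near: s.
  apply: (le_trans (integral_le_second_moment _ d0 _)).
    by move=> z; exact: Lnorm_ge0.
  have i0 : (0 <= ((delta s)^-1 / 2)%:E)%E by rewrite lee_fin divr_ge0// invr_ge0 ltW.
  apply: (le_trans (leeD (lexx _) (lee_wpmul2l i0 ls))).
  rewrite -EFinM -EFinD lee_fin.
  have -> : (delta s)^-1 / 2 * (K * delta s ^+ 2) = K * delta s / 2.
    by field; rewrite gt_eqF.
  have : delta s * (1 + K) < e by rewrite -ltr_pdivlMr// addr_gt0.
  have : 0 < delta s * (1 + K) by rewrite mulr_gt0// addr_gt0.
  lra.
by apply: cvg_within.
Unshelve. all: by end_near. Qed.
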